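(* Let $E$ be a finite directed graph with no sinks, with adjacency matrix $A$, and let $\mathcal{L}(E)$ be its Leavitt path algebra with coefficients in a field $K$. Then there is a group isomorphism $\phi:K_0^{\mathrm{gr}}(\mathcal{L}(E))\to\Delta_{A^t}$ such that $\phi(x\alpha)=\delta_{A^t}(\phi(\alpha))$ for all $\alpha\in K_0^{\mathrm{gr}}(\mathcal{L}(E))$, where $x$ is the generator of $\mathbb{Z}[x,x^{-1}]$, and $\phi\big(K_0^{\mathrm{gr}}(\mathcal{L}(E))_+\big)=\Delta_{A^t}^+$.
   Context: A directed graph $E=(E^0,E^1,r,s)$ has vertex set $E^0$, edge set $E^1$, and range and source maps $r,s:E^1\to E^0$; finite means $E^0,E^1$ finite; a sink is a vertex $v$ with $s^{-1}(v)=\varnothing$. After ordering $E^0=\{v_1,\dots,v_n\}$, the adjacency matrix is $A=(n_{ij})$, $n_{ij}$ the number of edges from $v_i$ to $v_j$; $A^t$ is its transpose. The Leavitt path algebra $\mathcal{L}(E)$ over $K$ is the $K$-algebra generated by $\{v: v\in E^0\}\cup\{\alpha,\alpha^*:\alpha\in E^1\}$ subject to: (1) $vw=\delta_{v,w}v$ for $v,w\in E^0$; (2) $s(\alpha)\alpha=\alpha r(\alpha)=\alpha$ and $r(\alpha)\alpha^*=\alpha^*s(\alpha)=\alpha^*$; (3) $\alpha^*\beta=\delta_{\alpha,\beta}r(\alpha)$ for $\alpha,\beta\in E^1$; (4) $\sum_{s(\alpha)=v}\alpha\alpha^*=v$ for every $v$ with $s^{-1}(v)\ne\varnothing$. It is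 $\mathbb{Z}$-graded by $\deg v=0$, $\deg\alpha=1$, $\deg\alpha^*=-1$. For a $\mathbb{Z}$-graded unital ring $B$, $K_0^{\mathrm{gr}}(B)$ is the group completion of the monoid (under $\oplus$) of graded isomorphism classes $[P]$ of graded finitely generated projective right $B$-modules; it is a $\mathbb{Z}[x,x^{-1}]$-module via $x[P]=[P(1)]$, where $P(1)_k=P_{1+k}$; $K_0^{\mathrm{gr}}(B)_+$ is the set of classes $[P]$. For a nonnegative integral $n\times n$ matrix $C$, $\Delta_C$ is the direct limit of $\mathbb{Z}^n\xrightarrow{C}\mathbb{Z}^n\xrightarrow{C}\cdots$ (acting on column vectors), with positive cone $\Delta_C^+$ the set of elements represented by some vector in $\mathbb{N}^n$ at some stage, and $\delta_C:\Delta_C\to\Delta_C$ is the automorphism induced by multiplication by $C$ at each stage (the triple $(\Delta_C,\Delta_C^+,\delta_C)$ is Krieger's dimension group). *)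

(* Defs.v *)
From HB Require Import structures.
From mathcomp Require Import all_boot all_order all_algebra generic_quotient.
From mathcomp Require Import boolp classical_sets zify.

Set Implicit Arguments.
Unset Strict Implicit.
Unset Printing Implicit Defensive.

Import GRing.Theory.
Local Open Scope ring_scope.
Local Open Scope quotient_scope.

(* Quotients that may live in a universe too large for {eq_quot _}: a class is
   the predicate it defines. *)
Section Quo.
Variables (T : Type) (R : T -> T -> Prop).

Definition quo : Type := {C : T -> Prop | exists x, C = R x}.

Definition quo_cls (x : T) : quo :=
  exist (fun C => exists x, C = R x) (R x) (ex_intro _ x erefl).

Definition quo_repr (c : quo) : T := projT1 (cid (proj2_sig c)).

Hypothesis Rrefl : forall x, R x x.
Hypothesis Rsym : forall x y, R x y -> R y x.
Hypothesis Rtrans : forall x y z, R x y -> R y z -> R x z.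

Lemma quo_reprK c : quo_cls (quo_repr c) = c.
Proof.
case: c => C HC; rewrite /quo_repr /=; case: (cid _) => x /= e.
by rewrite /quo_cls; apply: eq_exist; rewrite e.
Qed.

Lemma quo_eqP x y : quo_cls x = quo_cls y <-> R x y.
Proof.
split=> [[e]|xy].
  by have : R y y by []; rewrite -e.
apply: eq_exist; apply: funext => z; apply: propext; split=> h.
  exact: Rtrans (Rsym xy) h.
exact: Rtrans xy h.
Qed.

Lemma quo_reprP x : R (quo_repr (quo_cls x)) x.
Proof. by apply/quo_eqP; rewrite quo_reprK. Qed.
End Quo.

Section Grading.
Variables (V : zmodType) (c : int -> set V).

Record is_grading : Prop := IsGrading {
  grading0 : forall k, c k 0;
  gradingB : forall k x y, c k x -> c k y -> c k (x - y);
  grading_span : forall v, exists s : seq V,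
    (forall x, x \in s -> exists k, c k x) /\ v = \sum_(x <- s) x;
  grading_indep : forall (S : seq int) (f : int -> V), uniq S ->
    (forall k, c k (f k)) -> \sum_(k <- S) f k = 0 ->
    forall k, k \in S -> f k = 0
}.
End Grading.

Record gradedRing := GradedRing {
  gr_ring :> pzRingType;
  gr_comp : int -> set gr_ring;
  gr_grading : is_grading gr_comp;
  gr_one : gr_comp 0 1;
  gr_mul : forall i j x y, gr_comp i x -> gr_comp j y -> gr_comp (i + j) (x * y)
}.

(* Right B-modules are left modules over the converse ring B^c: the right
   action m . b is (b : B^c) *: m. *)
Record grModule (B : gradedRing) := GrModule {
  gm_mod :> lmodType B^c;
  gm_comp : int -> set gm_mod;
  gm_grading : is_grading gm_comp;
  gm_act : forall i j m (b : B), gm_comp i m -> gr_comp j b ->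
    gm_comp (i + j) ((b : B^c) *: m)
}.

Definition finitely_generated (R : pzRingType) (M : lmodType R) : Prop :=
  exists s : seq M, forall m : M,
    exists a : 'I_(size s) -> R, m = \sum_(i < size s) a i *: s`_i.

Definition projective (R : pzRingType) (M : lmodType R) : Prop :=
  forall (N N' : lmodType R) (g : {linear N -> N'}) (f : {linear M -> N'}),
    (forall y, exists x, g x = y) ->
    exists h : {linear M -> N}, forall m, g (h m) = f m.

(* Projectivity is that of the underlying module: for graded modules it agrees
   with projectivity in the category of graded modules. *)
Record grProj (B : gradedRing) := GrProj {
  gp_mod :> grModule B;
  gp_fg : finitely_generated gp_mod;
  gp_proj : projective gp_mod
}.

Lemma linear_ex (R : pzRingType) (U V : lmodType R) (f : U -> V) :
  linear f -> exists h : {linear U -> V}, h =1 f.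
Proof.
move=> fl; pose h := HB.pack_for {linear U -> V} f (GRing.isLinear.Build _ _ _ _ f fl).
by exists h.
Qed.

Section GradedModules.
Variable B : gradedRing.

Definition gr_iso (P Q : grModule B) : Prop :=
  exists f : {linear P -> Q}, bijective f /\
    forall k m, gm_comp k m <-> gm_comp k (f m).

Lemma gr_iso_refl P : gr_iso P P.
Proof. by exists idfun; split=> //; exists id. Qed.

Lemma gr_iso_sym P Q : gr_iso P Q -> gr_iso Q P.
Proof.
case=> f [[g fK gK] fc].
have gl : linear g.
  move=> a x y; apply: (can_inj fK); rewrite linearP !gK; by [].
have [h hE] := linear_ex gl; exists h; split.
  by exists f => x; rewrite hE ?fK ?gK.
by move=> k m; rewrite hE (fc k (g m)) gK.
Qed.

Lemma gr_iso_trans P Q S : gr_iso P Q -> gr_iso Q S -> gr_iso P S.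
Proof.
case=> f [bf fc] [g [bg gc]]; exists (g \o f); split; first exact: bij_comp.
by move=> k m; rewrite fc gc.
Qed.

Section Sum.
Variables P Q : grModule B.

Definition sum_comp (k : int) : set (P * Q)%type :=
  fun m => gm_comp k m.1 /\ gm_comp k m.2.

Lemma sum_grading : is_grading sum_comp.
Proof.
have [p0 pB pS pI] := gm_grading P; have [q0 qB qS qI] := gm_grading Q.
split.
- by move=> k; split.
- by move=> k x y [? ?] [? ?]; split; [apply: pB|apply: qB].
- move=> [v w]; have [s [hs ->]] := pS v; have [t [ht ->]] := qS w.
  exists ([seq (x, 0) | x <- s] ++ [seq (0, y) | y <- t]); split.
    move=> x; rewrite mem_cat => /orP[] /mapP[y yin ->].
      by have [k ck] := hs _ yin; exists k; split.
    by have [k ck] := ht _ yin; exists k; split.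
  rewrite big_cat !big_map /=.
  rewrite (_ : \sum_(j <- s) (j, 0) = (\sum_(j <- s) j, 0)); last first.
    elim: s {hs} => [|x s IH]; first by rewrite !big_nil.
    by rewrite !big_cons IH; congr pair; rewrite /= addr0.
  rewrite (_ : \sum_(j <- t) (0, j) = (0, \sum_(j <- t) j)); last first.
    elim: t {ht} => [|x t IH]; first by rewrite !big_nil.
    by rewrite !big_cons IH; congr pair; rewrite /= addr0.
  by congr pair; rewrite /= ?addr0 ?add0r.
- move=> S f uS hf s0 k kS.
  have e1 : \sum_(i <- S) (f i).1 = 0.
    by rewrite -[RHS]/((0 : P * Q).1) -s0; elim/big_rec2: _ => // i y1 y2 _ ->.
  have e2 : \sum_(i <- S) (f i).2 = 0.
    by rewrite -[RHS]/((0 : P * Q).2) -s0; elim/big_rec2: _ => // i y1 y2 _ ->.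
  rewrite [f k]surjective_pairing.
  rewrite (pI S (fun i => (f i).1) uS (fun i => (hf i).1) e1 k kS).
  by rewrite (qI S (fun i => (f i).2) uS (fun i => (hf i).2) e2 k kS).
Qed.

Lemma sum_act i j (m : P * Q) (b : B) : sum_comp i m -> gr_comp j b ->
  sum_comp (i + j) ((b : B^c) *: m).
Proof. by case=> ? ? ?; split; apply: gm_act. Qed.

Definition gm_sum : grModule B := GrModule sum_grading sum_act.
End Sum.

Section Shift.
Variables (P : grModule B) (n : int).

Definition shift_comp (k : int) : set P := gm_comp (n + k).

Lemma shift_grading : is_grading shift_comp.
Proof.
have [p0 pB pS pI] := gm_grading P; split.
- by move=> k; apply: p0.
- by move=> k x y; apply: pB.
- move=> v; have [s [hs ->]] := pS v; exists s; split=> // x /hs[k ck].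
  by exists (- n + k); rewrite /shift_comp addNKr.
- move=> S f uS hf s0 k kS.
  have := pI [seq n + i | i <- S] (fun i => f (- n + i)) _ _ _ (n + k).
  rewrite addKr; apply.
  + by rewrite map_inj_uniq //; apply: addrI.
  + by move=> i; have := hf (- n + i); rewrite /shift_comp addNKr.
  + by rewrite big_map -[RHS]s0; apply: eq_bigr => i _; rewrite addKr.
  + by apply/mapP; exists k.
Qed.

Lemma shift_act i j (m : P) (b : B) : shift_comp i m -> gr_comp j b ->
  shift_comp (i + j) ((b : B^c) *: m).
Proof. by rewrite /shift_comp addrA; apply: gm_act. Qed.

(* The underlying module is unchanged and P(n)_k = P_(n + k). *)
Definition gm_shift : grModule B := GrModule shift_grading shift_act.
End Shift.

Definition zero_comp (k : int) : set 'rV[B^c]_0 := fun=> True.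

Lemma rV0_eq (R : pzRingType) (x y : 'rV[R]_0) : x = y.
Proof. by apply/rowP => -[]. Qed.

Lemma zero_grading : is_grading zero_comp.
Proof.
split=> //; last by move=> *; apply: rV0_eq.
by move=> v; exists [::]; split=> //; apply: rV0_eq.
Qed.

Definition gm_zero : grModule B :=
  @GrModule B 'rV[B^c]_0 zero_comp zero_grading (fun _ _ _ _ _ _ => I).

Lemma sum_fg (P Q : grModule B) :
  finitely_generated P -> finitely_generated Q ->
  finitely_generated (gm_sum P Q).
Proof.
move=> [s hs] [t ht].
have spanE (M : lmodType B^c) (r : seq M) (m : M) :
    (exists a : nat -> B^c, m = \sum_(i < size r) a i *: r`_i) ->
    exists a : 'I_(size r) -> B^c, m = \sum_(i < size r) a i *: r`_i.
  by case=> a ->; exists (fun i => a i).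
have ext k (a : 'I_k -> B^c) : exists b : nat -> B^c, forall i : 'I_k, b i = a i.
  exists (fun i => if insub i is Some j then a j else 0) => i.
  by rewrite valK.
exists ([seq (x, 0) | x <- s] ++ [seq (0, y) | y <- t]) => -[v w].
apply: (spanE (P * Q)%type).
have [a ->] := hs v; have [b ->] := ht w.
have [a' ha] := ext _ a; have [b' hb] := ext _ b.
exists (fun i => if (i < size s)%N then a' i else b' (i - size s)%N).
rewrite size_cat !size_map big_split_ord /=.
have lE : \sum_(i < size s)
    (if (i < size s)%N then a' i else b' (i - size s)%N) *:
      ([seq (x, 0) | x <- s] ++ [seq (0, y) | y <- t] : seq (P * Q))`_i =
    (\sum_(i < size s) a i *: s`_i, 0).
  elim/big_rec2: _ => // i y1 y2 _ ->.
  rewrite ltn_ord nth_cat size_map ltn_ord (nth_map 0) // ha.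
  by congr pair; rewrite /= ?scaler0 ?addr0.
have rE : \sum_(i < size t)
    (if (size s + i < size s)%N then a' (size s + i)%N
     else b' (size s + i - size s)%N) *:
      ([seq (x, 0) | x <- s] ++ [seq (0, y) | y <- t] : seq (P * Q))`_(size s + i) =
    (0, \sum_(i < size t) b i *: t`_i).
  elim/big_rec2: _ => // i y1 y2 _ ->.
  rewrite ltnNge leq_addr /= addKn nth_cat size_map ltnNge leq_addr /= addKn.
  rewrite (nth_map 0) // hb.
  by congr pair; rewrite /= ?scaler0 ?addr0.
by rewrite lE rE; congr pair; rewrite /= ?addr0 ?add0r.
Qed.

Lemma sum_projective (P Q : grModule B) :
  projective P -> projective Q -> projective (gm_sum P Q).
Proof.
move=> hP hQ N N' g f gs.
have il : linear (fun x : P => (x, 0) : (P * Q)%type).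
  by move=> a x y; congr pair; rewrite /= ?scaler0 ?addr0.
have ir : linear (fun y : Q => (0, y) : (P * Q)%type).
  by move=> a x y; congr pair; rewrite /= ?scaler0 ?addr0.
have [iP iPE] := linear_ex il; have [iQ iQE] := linear_ex ir.
have [h1 e1] := hP _ _ g (f \o iP) gs.
have [h2 e2] := hQ _ _ g (f \o iQ) gs.
have hl : linear (fun z : (P * Q)%type => h1 z.1 + h2 z.2).
  by move=> a x y; rewrite /= !linearP scalerDr addrACA.
have [h hE] := linear_ex hl; exists h => z.
rewrite hE linearD e1 e2 /= -linearD iPE iQE.
by congr (f _); rewrite [RHS]surjective_pairing; congr pair; rewrite /= ?addr0 ?add0r.
Qed.

Lemma zero_fg : finitely_generated gm_zero.
Proof. by exists [::] => m; exists (fun=> 0); apply: rV0_eq. Qed.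

Lemma zero_projective : projective gm_zero.
Proof.
move=> N N' g f gs; exists \0 => m.
by rewrite (rV0_eq m 0) !linear0.
Qed.

Definition gp_sum (P Q : grProj B) : grProj B :=
  GrProj (sum_fg (gp_fg P) (gp_fg Q)) (sum_projective (@gp_proj _ P) (@gp_proj _ Q)).

Definition gp_zero : grProj B := GrProj zero_fg zero_projective.

Definition gp_shift (n : int) (P : grProj B) : grProj B :=
  @GrProj B (gm_shift P n) (gp_fg P) (@gp_proj _ P).

Lemma gm_sum_iso P P' Q Q' :
  gr_iso P P' -> gr_iso Q Q' -> gr_iso (gm_sum P Q) (gm_sum P' Q').
Proof.
move=> [f [[f' fK fK'] fc]] [g [[g' gK gK'] gc]].
have hl : linear (fun z : (P * Q)%type => (f z.1, g z.2) : (P' * Q')%type).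
  by move=> a x y; rewrite /= !linearP.
have [h hE] := linear_ex hl; exists h; split.
  exists (fun z : (P' * Q')%type => (f' z.1, g' z.2)).
    by case=> x y; rewrite hE /= fK gK.
  by case=> x y; rewrite hE /= fK' gK'.
by move=> k m; rewrite hE; split=> -[]; split; apply/fc || apply/gc.
Qed.

Lemma gm_sumC P Q : gr_iso (gm_sum P Q) (gm_sum Q P).
Proof.
have hl : linear (fun z : (P * Q)%type => (z.2, z.1) : (Q * P)%type) by [].
have [h hE] := linear_ex hl; exists h; split.
  by exists (fun z : (Q * P)%type => (z.2, z.1)); case=> x y; rewrite hE.
by move=> k m; rewrite hE; split=> -[]; split.
Qed.

Lemma gm_sumA P Q S : gr_iso (gm_sum P (gm_sum Q S)) (gm_sum (gm_sum P Q) S).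
Proof.
have hl : linear (fun z : (P * (Q * S))%type =>
    ((z.1, z.2.1), z.2.2) : ((P * Q) * S)%type) by [].
have [h hE] := linear_ex hl; exists h; split.
  exists (fun z : ((P * Q) * S)%type => (z.1.1, (z.1.2, z.2))).
    by case=> x [y z]; rewrite hE.
  by case=> [[x y] z]; rewrite hE.
by move=> k m; rewrite hE; split=> [[? []]|[[]]]; do ?split.
Qed.

Lemma gm_sum0 P : gr_iso (gm_sum gm_zero P) P.
Proof.
have hl : linear (fun z : ('rV[B^c]_0 * P)%type => z.2) by [].
have [h hE] := linear_ex hl; exists h; split.
  exists (fun x : P => (0, x) : ('rV[B^c]_0 * P)%type) => x; rewrite hE //.
  by case: x => x y; congr pair; apply: rV0_eq.
by move=> k m; rewrite hE; split=> [[]|]; do ?split.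
Qed.

Lemma gm_shift_iso n P Q : gr_iso P Q -> gr_iso (gm_shift P n) (gm_shift Q n).
Proof. by case=> f [bf fc]; exists f; split=> // k m; apply: fc. Qed.

Lemma gm_shift_sum n P Q :
  gr_iso (gm_shift (gm_sum P Q) n) (gm_sum (gm_shift P n) (gm_shift Q n)).
Proof. by exists idfun; split=> //; exists id. Qed.

Lemma gm_shiftD m n P : gr_iso (gm_shift (gm_shift P n) m) (gm_shift P (n + m)).
Proof.
exists idfun; split; first by exists id.
by move=> k x; rewrite /gm_comp /= /shift_comp /= addrA.
Qed.

Lemma gm_shift0 P : gr_iso (gm_shift P 0) P.
Proof.
exists idfun; split; first by exists id.
by move=> k x; rewrite {1}/gm_comp /= /shift_comp /= add0r.
Qed.

Definition grVmon : Type := quo (fun P Q : grProj B => gr_iso P Q).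

Definition grV_cls (P : grProj B) : grVmon :=
  quo_cls (fun P Q : grProj B => gr_iso P Q) P.

Definition grV_add (a b : grVmon) : grVmon :=
  grV_cls (gp_sum (quo_repr a) (quo_repr b)).

Definition grV_shift (n : int) (a : grVmon) : grVmon :=
  grV_cls (gp_shift n (quo_repr a)).

Lemma grV_eqP (P Q : grProj B) : grV_cls P = grV_cls Q <-> gr_iso P Q.
Proof.
apply: quo_eqP.
- by move=> ?; apply: gr_iso_refl.
- by move=> ? ?; apply: gr_iso_sym.
- by move=> ? ? ?; apply: gr_iso_trans.
Qed.

Lemma grV_reprP (P : grProj B) : gr_iso (quo_repr (grV_cls P)) P.
Proof. by apply/grV_eqP; rewrite /grV_cls quo_reprK. Qed.

Lemma grV_ind (p : grVmon -> Prop) : (forall P, p (grV_cls P)) -> forall a, p a.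
Proof. by move=> h a; rewrite -(quo_reprK a); apply: h. Qed.

Lemma grV_addE P Q : grV_add (grV_cls P) (grV_cls Q) = grV_cls (gp_sum P Q).
Proof. by apply/grV_eqP; apply: gm_sum_iso; apply: grV_reprP. Qed.

Lemma grV_shiftE n P : grV_shift n (grV_cls P) = grV_cls (gp_shift n P).
Proof. by apply/grV_eqP; apply: gm_shift_iso; apply: grV_reprP. Qed.

Lemma grV_addC a b : grV_add a b = grV_add b a.
Proof.
elim/grV_ind: a => P; elim/grV_ind: b => Q; rewrite !grV_addE.
by apply/grV_eqP; apply: gm_sumC.
Qed.

Lemma grV_addA a b c : grV_add a (grV_add b c) = grV_add (grV_add a b) c.
Proof.
elim/grV_ind: a => P; elim/grV_ind: b => Q; elim/grV_ind: c => S.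
by rewrite !grV_addE; apply/grV_eqP; apply: gm_sumA.
Qed.

Lemma grV_add0 a : grV_add (grV_cls gp_zero) a = a.
Proof.
by elim/grV_ind: a => P; rewrite grV_addE; apply/grV_eqP; apply: gm_sum0.
Qed.

Lemma grV_shift_add n a b :
  grV_shift n (grV_add a b) = grV_add (grV_shift n a) (grV_shift n b).
Proof.
elim/grV_ind: a => P; elim/grV_ind: b => Q.
by rewrite !(grV_addE, grV_shiftE); apply/grV_eqP; apply: gm_shift_sum.
Qed.

Lemma grV_shiftD m n a : grV_shift m (grV_shift n a) = grV_shift (n + m) a.
Proof.
by elim/grV_ind: a => P; rewrite !grV_shiftE; apply/grV_eqP; apply: gm_shiftD.
Qed.

Lemma grV_shift0 a : grV_shift 0 a = a.
Proof.
by elim/grV_ind: a => P; rewrite !grV_shiftE; apply/grV_eqP; apply: gm_shift0.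
Qed.

(* The pair (a, b) stands for the formal difference a - b. *)
Definition K0_rel (p q : grVmon * grVmon) : Prop :=
  exists s, grV_add (grV_add p.1 q.2) s = grV_add (grV_add q.1 p.2) s.

(* K0gr lives in a universe strictly above that of lmodType, hence it cannot
   carry a zmodType structure: its group laws are stated separately below. *)
Definition K0gr : Type := quo K0_rel.

Definition K0gr_diff (a b : grVmon) : K0gr := quo_cls K0_rel (a, b).

Definition K0gr_cls (P : grProj B) : K0gr :=
  K0gr_diff (grV_cls P) (grV_cls gp_zero).

Definition K0gr_zero : K0gr := K0gr_diff (grV_cls gp_zero) (grV_cls gp_zero).

Definition K0gr_add (u v : K0gr) : K0gr :=
  K0gr_diff (grV_add (quo_repr u).1 (quo_repr v).1)
            (grV_add (quo_repr u).2 (quo_repr v).2).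

Definition K0gr_opp (u : K0gr) : K0gr :=
  K0gr_diff (quo_repr u).2 (quo_repr u).1.

(* The action of the monomial x ^ n of Z[x, x^-1]. *)
Definition K0gr_shift (n : int) (u : K0gr) : K0gr :=
  K0gr_diff (grV_shift n (quo_repr u).1) (grV_shift n (quo_repr u).2).

Definition K0gr_x (u : K0gr) : K0gr := K0gr_shift 1 u.

Definition K0gr_pos (u : K0gr) : Prop := exists P : grProj B, u = K0gr_cls P.

Let addAC a b c : grV_add (grV_add a b) c = grV_add (grV_add a c) b.
Proof. by rewrite -!grV_addA (grV_addC b). Qed.

Let addACA a b c d :
  grV_add (grV_add a b) (grV_add c d) = grV_add (grV_add a c) (grV_add b d).
Proof. by rewrite !grV_addA (addAC a b c). Qed.

Lemma K0_rel_refl p : K0_rel p p.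
Proof. by exists p.1. Qed.

Lemma K0_rel_sym p q : K0_rel p q -> K0_rel q p.
Proof. by case=> s e; exists s. Qed.

Lemma K0_rel_trans p q r : K0_rel p q -> K0_rel q r -> K0_rel p r.
Proof.
case: p q r => [p1 p2] [q1 q2] [r1 r2] [s /= e] [t /= e'].
exists (grV_add (grV_add q1 q2) (grV_add s t)).
have -> : grV_add (grV_add p1 r2) (grV_add (grV_add q1 q2) (grV_add s t)) =
    grV_add (grV_add (grV_add p1 q2) s) (grV_add (grV_add q1 r2) t).
  rewrite [LHS]grV_addA [RHS]addACA; congr (grV_add _ _).
  by rewrite [LHS]addACA [RHS]addACA (grV_addC r2).
rewrite e e' [LHS]addACA [RHS]grV_addA; congr (grV_add _ _).
by rewrite [LHS]grV_addC [LHS]addACA [RHS]addACA (grV_addC q2).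
Qed.

Lemma K0gr_diffP a b c d :
  K0gr_diff a b = K0gr_diff c d <-> K0_rel (a, b) (c, d).
Proof. exact: quo_eqP K0_rel_refl K0_rel_sym K0_rel_trans _ _. Qed.

Lemma K0gr_reprP a b : K0_rel (quo_repr (K0gr_diff a b)) (a, b).
Proof. exact: quo_reprP K0_rel_refl K0_rel_sym K0_rel_trans _. Qed.

Lemma K0gr_ind (p : K0gr -> Prop) :
  (forall a b, p (K0gr_diff a b)) -> forall u, p u.
Proof. by move=> h u; rewrite -(quo_reprK u); case: (quo_repr u) => a b; apply: h. Qed.

Lemma K0gr_addE a b c d :
  K0gr_add (K0gr_diff a b) (K0gr_diff c d) =
  K0gr_diff (grV_add a c) (grV_add b d).
Proof.
apply/K0gr_diffP; have := K0gr_reprP a b; have := K0gr_reprP c d.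
case: (quo_repr (K0gr_diff a b)) => p1 p2.
case: (quo_repr (K0gr_diff c d)) => q1 q2 [t /= e'] [s /= e].
exists (grV_add s t) => /=.
by rewrite (addACA p1) [LHS]addACA e e' (addACA a) [RHS]addACA.
Qed.

Lemma K0gr_oppE a b : K0gr_opp (K0gr_diff a b) = K0gr_diff b a.
Proof.
apply/K0gr_diffP; have := K0gr_reprP a b.
move: (quo_repr _) => [p1 p2] [s /= e].
by exists s => /=; rewrite (grV_addC p2) (grV_addC b) e.
Qed.

Lemma K0gr_shiftE n a b :
  K0gr_shift n (K0gr_diff a b) = K0gr_diff (grV_shift n a) (grV_shift n b).
Proof.
apply/K0gr_diffP; have := K0gr_reprP a b.
move: (quo_repr _) => [p1 p2] [s /= e].
by exists (grV_shift n s) => /=; rewrite -!grV_shift_add e.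
Qed.

Lemma K0gr_addC u v : K0gr_add u v = K0gr_add v u.
Proof.
elim/K0gr_ind: u => a b; elim/K0gr_ind: v => c d; rewrite !K0gr_addE.
by rewrite (grV_addC a) (grV_addC b).
Qed.

Lemma K0gr_addA u v w : K0gr_add u (K0gr_add v w) = K0gr_add (K0gr_add u v) w.
Proof.
elim/K0gr_ind: u => a b; elim/K0gr_ind: v => c d; elim/K0gr_ind: w => e f.
by rewrite !K0gr_addE !grV_addA.
Qed.

Lemma K0gr_add0 u : K0gr_add K0gr_zero u = u.
Proof. by elim/K0gr_ind: u => a b; rewrite K0gr_addE !grV_add0. Qed.

Lemma K0gr_addN u : K0gr_add (K0gr_opp u) u = K0gr_zero.
Proof.
elim/K0gr_ind: u => a b; rewrite K0gr_oppE K0gr_addE; apply/K0gr_diffP.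
by exists a => /=; rewrite (grV_addC b) -(grV_addC (grV_cls gp_zero)).
Qed.

Lemma K0gr_cls_sum P Q :
  K0gr_cls (gp_sum P Q) = K0gr_add (K0gr_cls P) (K0gr_cls Q).
Proof. by rewrite K0gr_addE grV_addE grV_add0. Qed.

Lemma K0gr_cls_iso (P Q : grProj B) : gr_iso P Q -> K0gr_cls P = K0gr_cls Q.
Proof. by move/grV_eqP => e; rewrite /K0gr_cls e. Qed.

Lemma K0gr_clsB u : exists P Q, u = K0gr_add (K0gr_cls P) (K0gr_opp (K0gr_cls Q)).
Proof.
elim/K0gr_ind: u => a b; elim/grV_ind: a => P; elim/grV_ind: b => Q.
exists P, Q; rewrite K0gr_oppE K0gr_addE grV_add0.
by rewrite (grV_addC (grV_cls P)) grV_add0.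
Qed.

Lemma K0gr_x_cls P : K0gr_x (K0gr_cls P) = K0gr_cls (gp_shift 1 P).
Proof.
rewrite /K0gr_x K0gr_shiftE !grV_shiftE; apply/K0gr_diffP.
exists (grV_cls P) => /=; congr (grV_add (grV_add _ _) _).
by apply/grV_eqP; exists idfun; split=> //; exists id.
Qed.

Lemma K0gr_shift_add n u v :
  K0gr_shift n (K0gr_add u v) = K0gr_add (K0gr_shift n u) (K0gr_shift n v).
Proof.
elim/K0gr_ind: u => a b; elim/K0gr_ind: v => c d.
by rewrite !(K0gr_addE, K0gr_shiftE) !grV_shift_add.
Qed.

Lemma K0gr_shiftD m n u : K0gr_shift m (K0gr_shift n u) = K0gr_shift (n + m) u.
Proof. by elim/K0gr_ind: u => a b; rewrite !K0gr_shiftE !grV_shiftD. Qed.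

Lemma K0gr_shift0 u : K0gr_shift 0 u = u.
Proof. by elim/K0gr_ind: u => a b; rewrite !K0gr_shiftE !grV_shift0. Qed.

End GradedModules.

Section DimensionGroup.
Variables (n : nat) (C : 'M[nat]_n).

Let Cz : 'M[int]_n := map_mx Posz C.

(* The pair (i, u) stands for the vector u at stage i of the direct system. *)
Definition dim_raw : Type := nat * 'cV[int]_n.

Definition dim_rel (p q : dim_raw) : Prop :=
  exists k l : nat, (p.1 + k = q.1 + l)%N /\ Cz ^+ k *m p.2 = Cz ^+ l *m q.2.

Lemma powD k l (u : 'cV[int]_n) : Cz ^+ k *m (Cz ^+ l *m u) = Cz ^+ (k + l) *m u.
Proof. by rewrite mulmxA exprD. Qed.

Lemma powC k (u : 'cV[int]_n) : Cz ^+ k *m (Cz *m u) = Cz *m (Cz ^+ k *m u).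
Proof. by have := powD k 1 u; rewrite addnC -powD !expr1. Qed.

Lemma dim_rel_equiv : equiv_class_of (fun p q => `[< dim_rel p q >]).
Proof.
split.
- by move=> p; apply/asboolP; exists 0%N, 0%N.
- by move=> p q; apply/asboolP/asboolP => -[k [l [e1 e2]]]; exists l, k.
- move=> q p r /asboolP[k [l [e1 e2]]] /asboolP[k' [l' [e1' e2']]].
  apply/asboolP; exists (k' + k)%N, (l + l')%N; split.
    by lia.
  by rewrite -powD e2 powD addnC -powD e2' powD.
Qed.

Canonical dim_equiv := EquivRelPack dim_rel_equiv.

Definition dim_group : Type := {eq_quot dim_equiv}.

HB.instance Definition _ := Choice.on dim_group.
HB.instance Definition _ := EqQuotient.on dim_group.

Definition dim_cls (i : nat) (u : 'cV[int]_n) : dim_group := \pi_dim_group (i, u).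

Lemma dim_eqP i u j v :
  dim_cls i u = dim_cls j v <-> dim_rel (i, u) (j, v).
Proof.
split; first by move=> /eqmodP/asboolP.
by move=> h; apply/eqmodP/asboolP.
Qed.

Lemma dim_ind (p : dim_group -> Prop) :
  (forall i u, p (dim_cls i u)) -> forall d, p d.
Proof.
by move=> h d; rewrite -(reprK d); case: (repr d) => i u; apply: h.
Qed.

Lemma dim_reprP i u : dim_rel (repr (dim_cls i u)) (i, u).
Proof.
case E : (repr (dim_cls i u)) => [j v]; apply/dim_eqP.
by rewrite /dim_cls -E reprK.
Qed.

Definition dim_zero : dim_group := dim_cls 0 0.

Definition dim_add (d e : dim_group) : dim_group :=
  dim_cls ((repr d).1 + (repr e).1)
    (Cz ^+ (repr e).1 *m (repr d).2 + Cz ^+ (repr d).1 *m (repr e).2).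

Definition dim_opp (d : dim_group) : dim_group :=
  dim_cls (repr d).1 (- (repr d).2).

Lemma dim_addE i u j v :
  dim_add (dim_cls i u) (dim_cls j v) =
  dim_cls (i + j) (Cz ^+ j *m u + Cz ^+ i *m v).
Proof.
apply/dim_eqP; have := dim_reprP i u; have := dim_reprP j v.
case: (repr (dim_cls i u)) => i' u'; case: (repr (dim_cls j v)) => j' v'.
move=> [k [l /= [e1 e2]]] [k' [l' /= [e1' e2']]].
exists (k' + k)%N, (l' + l)%N; split; first by rewrite /=; lia.
rewrite !mulmxDr !powD; congr (_ + _).
  rewrite (_ : (k' + k + j' = (j' + k) + k')%N); last by lia.
  by rewrite -powD e2' powD e1; congr (_ ^+ _ *m _); lia.
rewrite (_ : (k' + k + i' = (i' + k') + k)%N); last by lia.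
by rewrite -powD e2 powD e1'; congr (_ ^+ _ *m _); lia.
Qed.

Lemma dim_oppE i u : dim_opp (dim_cls i u) = dim_cls i (- u).
Proof.
apply/dim_eqP; have := dim_reprP i u.
case: (repr _) => i' u' [k [l /= [e1 e2]]].
by exists k, l; split; rewrite //= !mulmxN e2.
Qed.

Lemma dim_addA : associative dim_add.
Proof.
elim/dim_ind=> i u; elim/dim_ind=> j v; elim/dim_ind=> k w.
rewrite !dim_addE addnA; congr dim_cls.
by rewrite !mulmxDr !powD addrA (addnC k j) (addnC k i).
Qed.

Lemma dim_addC : commutative dim_add.
Proof.
by elim/dim_ind=> i u; elim/dim_ind=> j v; rewrite !dim_addE addnC addrC.
Qed.

Lemma dim_add0 : left_id dim_zero dim_add.
Proof.
by elim/dim_ind=> i u; rewrite dim_addE mulmx0 add0r expr0 mul1mx.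
Qed.

Lemma dim_addN : left_inverse dim_zero dim_opp dim_add.
Proof.
elim/dim_ind=> i u; rewrite dim_oppE dim_addE -mulmxDr addNr mulmx0.
by apply/dim_eqP; exists 0%N, (i + i)%N; rewrite /= !mulmx0 addn0.
Qed.

HB.instance Definition _ :=
  GRing.isZmodule.Build dim_group dim_addA dim_addC dim_add0 dim_addN.

Lemma dim_clsD i u v : dim_cls i (u + v) = dim_cls i u + dim_cls i v.
Proof.
rewrite [RHS]dim_addE; apply/dim_eqP; exists i, 0%N.
by rewrite /= addn0 expr0 mul1mx -mulmxDr.
Qed.

Lemma dim_clsS i u : dim_cls i.+1 (Cz *m u) = dim_cls i u.
Proof.
by apply/dim_eqP; exists 0%N, 1%N; rewrite /= addn0 addn1 expr0 mul1mx expr1.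
Qed.

Definition dim_pos (d : dim_group) : Prop :=
  exists (i : nat) (u : 'cV[nat]_n), d = dim_cls i (map_mx Posz u).

Definition dim_delta (d : dim_group) : dim_group :=
  dim_cls (repr d).1 (Cz *m (repr d).2).

Lemma dim_deltaE i u : dim_delta (dim_cls i u) = dim_cls i (Cz *m u).
Proof.
apply/dim_eqP; have := dim_reprP i u.
case: (repr _) => i' u' [k [l /= [e1 e2]]].
exists k, l; split=> //=.
by rewrite !powC e2.
Qed.

Lemma dim_delta_additive d e : dim_delta (d + e) = dim_delta d + dim_delta e.
Proof.
elim/dim_ind: d => i u; elim/dim_ind: e => j v.
rewrite [_ + dim_cls j v]dim_addE !dim_deltaE [RHS]dim_addE mulmxDr.
by rewrite !powC.
Qed.

Lemma dim_delta_bij : bijective dim_delta.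
Proof.
exists (fun d => dim_cls (repr d).1.+1 (repr d).2).
  elim/dim_ind => i u; rewrite dim_deltaE.
  have := dim_reprP i (Cz *m u).
  case: (repr _) => i' u' [k [l /= [e1 e2]]].
  rewrite -(dim_clsS i); apply/dim_eqP; exists k, l; split=> //=.
  by rewrite !addSn e1.
elim/dim_ind => i u; rewrite dim_deltaE dim_clsS /dim_cls.
by rewrite -surjective_pairing reprK.
Qed.
End DimensionGroup.

Record finDigraph := FinDigraph {
  vertex : finType;
  edge : finType;
  src : edge -> vertex;
  rng : edge -> vertex
}.

Definition adjacency (E : finDigraph) (n : nat) (o : 'I_n -> vertex E) :
    'M[nat]_n :=
  \matrix_(i, j) #|[set a : edge E | (src a == o i) && (rng a == o j)]|.

Section Leavitt.
Variables (K : fieldType) (E : finDigraph).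

Inductive lpa_term : Type :=
| lvert of vertex E
| ledge of edge E
| lghost of edge E
| lzero
| lopp of lpa_term
| ladd of lpa_term & lpa_term
| lscale of K & lpa_term
| lmul of lpa_term & lpa_term.

(* The least congruence making the terms a (not a priori unital) associative
   K-algebra in which the Leavitt relations hold. *)
Inductive lpa_rel : lpa_term -> lpa_term -> Prop :=
| lpa_refl t : lpa_rel t t
| lpa_sym t u : lpa_rel t u -> lpa_rel u t
| lpa_trans t u w : lpa_rel t u -> lpa_rel u w -> lpa_rel t w
| lpa_opp t t' : lpa_rel t t' -> lpa_rel (lopp t) (lopp t')
| lpa_add t t' u u' : lpa_rel t t' -> lpa_rel u u' ->
    lpa_rel (ladd t u) (ladd t' u')
| lpa_scale a t t' : lpa_rel t t' -> lpa_rel (lscale a t) (lscale a t')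
| lpa_mul t t' u u' : lpa_rel t t' -> lpa_rel u u' ->
    lpa_rel (lmul t u) (lmul t' u')
| lpa_addA t u w : lpa_rel (ladd t (ladd u w)) (ladd (ladd t u) w)
| lpa_addC t u : lpa_rel (ladd t u) (ladd u t)
| lpa_add0 t : lpa_rel (ladd lzero t) t
| lpa_addN t : lpa_rel (ladd (lopp t) t) lzero
| lpa_scaleA a b t : lpa_rel (lscale a (lscale b t)) (lscale (a * b) t)
| lpa_scale1 t : lpa_rel (lscale 1 t) t
| lpa_scaleDr a t u :
    lpa_rel (lscale a (ladd t u)) (ladd (lscale a t) (lscale a u))
| lpa_scaleDl a b t :
    lpa_rel (lscale (a + b) t) (ladd (lscale a t) (lscale b t))
| lpa_mulA t u w : lpa_rel (lmul t (lmul u w)) (lmul (lmul t u) w)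
| lpa_mulDl t u w : lpa_rel (lmul (ladd t u) w) (ladd (lmul t w) (lmul u w))
| lpa_mulDr t u w : lpa_rel (lmul t (ladd u w)) (ladd (lmul t u) (lmul t w))
| lpa_scaleAl a t u : lpa_rel (lscale a (lmul t u)) (lmul (lscale a t) u)
| lpa_scaleAr a t u : lpa_rel (lscale a (lmul t u)) (lmul t (lscale a u))
| lpa_vv v w : lpa_rel (lmul (lvert v) (lvert w))
    (if v == w then lvert v else lzero)
| lpa_se a : lpa_rel (lmul (lvert (src a)) (ledge a)) (ledge a)
| lpa_er a : lpa_rel (lmul (ledge a) (lvert (rng a))) (ledge a)
| lpa_rg a : lpa_rel (lmul (lvert (rng a)) (lghost a)) (lghost a)
| lpa_gs a : lpa_rel (lmul (lghost a) (lvert (src a))) (lghost a)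
| lpa_ge a b : lpa_rel (lmul (lghost a) (ledge b))
    (if a == b then lvert (rng a) else lzero)
| lpa_eg v : (exists a, src a = v) ->
    lpa_rel (\big[ladd/lzero]_(a : edge E | src a == v)
               lmul (ledge a) (lghost a)) (lvert v).

HB.instance Definition _ := gen_eqMixin lpa_term.
HB.instance Definition _ := gen_choiceMixin lpa_term.

Lemma lpa_rel_equiv : equiv_class_of (fun t u => `[< lpa_rel t u >]).
Proof.
split.
- by move=> t; apply/asboolP; apply: lpa_refl.
- by move=> t u; apply/asboolP/asboolP; apply: lpa_sym.
- move=> u t w /asboolP tu /asboolP uw; apply/asboolP.
  exact: lpa_trans tu uw.
Qed.

Canonical lpa_equiv := EquivRelPack lpa_rel_equiv.

Definition leavitt : Type := {eq_quot lpa_equiv}.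

HB.instance Definition _ := Choice.on leavitt.
HB.instance Definition _ := EqQuotient.on leavitt.

Definition lpa_cls (t : lpa_term) : leavitt := \pi_leavitt t.

Lemma lpa_eqP t u : lpa_cls t = lpa_cls u <-> lpa_rel t u.
Proof.
split; first by move=> /eqmodP/asboolP.
by move=> h; apply/eqmodP/asboolP.
Qed.

Lemma lpa_ind (p : leavitt -> Prop) :
  (forall t, p (lpa_cls t)) -> forall x, p x.
Proof. by move=> h x; rewrite -(reprK x). Qed.

Lemma lpa_reprP t : lpa_rel (repr (lpa_cls t)) t.
Proof. by apply/lpa_eqP; rewrite /lpa_cls reprK. Qed.

Definition leavitt_add (x y : leavitt) := lpa_cls (ladd (repr x) (repr y)).
Definition leavitt_opp (x : leavitt) := lpa_cls (lopp (repr x)).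
Definition leavitt_mul (x y : leavitt) := lpa_cls (lmul (repr x) (repr y)).
Definition leavitt_scale (a : K) (x : leavitt) := lpa_cls (lscale a (repr x)).

Lemma leavitt_addE t u :
  leavitt_add (lpa_cls t) (lpa_cls u) = lpa_cls (ladd t u).
Proof. by apply/lpa_eqP; apply: lpa_add; apply: lpa_reprP. Qed.

Lemma leavitt_oppE t : leavitt_opp (lpa_cls t) = lpa_cls (lopp t).
Proof. by apply/lpa_eqP; apply: lpa_opp; apply: lpa_reprP. Qed.

Lemma leavitt_mulE t u :
  leavitt_mul (lpa_cls t) (lpa_cls u) = lpa_cls (lmul t u).
Proof. by apply/lpa_eqP; apply: lpa_mul; apply: lpa_reprP. Qed.

Lemma leavitt_scaleE a t : leavitt_scale a (lpa_cls t) = lpa_cls (lscale a t).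
Proof. by apply/lpa_eqP; apply: lpa_scale; apply: lpa_reprP. Qed.

Fact leavitt_addA : associative leavitt_add.
Proof.
elim/lpa_ind=> t; elim/lpa_ind=> u; elim/lpa_ind=> w.
by rewrite !leavitt_addE; apply/lpa_eqP/lpa_addA.
Qed.

Fact leavitt_addC : commutative leavitt_add.
Proof.
elim/lpa_ind=> t; elim/lpa_ind=> u.
by rewrite !leavitt_addE; apply/lpa_eqP/lpa_addC.
Qed.

Fact leavitt_add0 : left_id (lpa_cls lzero) leavitt_add.
Proof. by elim/lpa_ind=> t; rewrite !leavitt_addE; apply/lpa_eqP/lpa_add0. Qed.

Fact leavitt_addN : left_inverse (lpa_cls lzero) leavitt_opp leavitt_add.
Proof.
by elim/lpa_ind=> t; rewrite leavitt_oppE leavitt_addE; apply/lpa_eqP/lpa_addN.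
Qed.

HB.instance Definition _ := GRing.isZmodule.Build leavitt
  leavitt_addA leavitt_addC leavitt_add0 leavitt_addN.

Lemma lpa_cls_sum (I : finType) (P : pred I) (F : I -> lpa_term) :
  lpa_cls (\big[ladd/lzero]_(i | P i) F i) = \sum_(i | P i) lpa_cls (F i).
Proof.
elim/big_rec2: _ => // i y1 y2 _ <-.
by rewrite [RHS]leavitt_addE.
Qed.

(* For a finite set of vertices the sum of the vertices is a unit. *)
Definition leavitt_one : leavitt := \sum_(v : vertex E) lpa_cls (lvert v).

Fact leavitt_mulA : associative leavitt_mul.
Proof.
elim/lpa_ind=> t; elim/lpa_ind=> u; elim/lpa_ind=> w.
by rewrite !leavitt_mulE; apply/lpa_eqP/lpa_mulA.
Qed.

Fact leavitt_mulDl : left_distributive leavitt_mul +%R.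
Proof.
elim/lpa_ind=> t; elim/lpa_ind=> u; elim/lpa_ind=> w.
rewrite [lpa_cls t + _]leavitt_addE !leavitt_mulE [RHS]leavitt_addE.
exact/lpa_eqP/lpa_mulDl.
Qed.

Fact leavitt_mulDr : right_distributive leavitt_mul +%R.
Proof.
elim/lpa_ind=> t; elim/lpa_ind=> u; elim/lpa_ind=> w.
rewrite [lpa_cls u + _]leavitt_addE !leavitt_mulE [RHS]leavitt_addE.
exact/lpa_eqP/lpa_mulDr.
Qed.

Let lmulSl I (r : seq I) (P : pred I) (F : I -> leavitt) x :
  leavitt_mul (\sum_(i <- r | P i) F i) x = \sum_(i <- r | P i) leavitt_mul (F i) x.
Proof.
apply: (big_morph (leavitt_mul^~ x)); first by move=> ? ?; rewrite leavitt_mulDl.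
by apply: (@addrI _ (leavitt_mul 0 x)); rewrite -leavitt_mulDl !addr0.
Qed.

Let lmulSr I (r : seq I) (P : pred I) (F : I -> leavitt) x :
  leavitt_mul x (\sum_(i <- r | P i) F i) = \sum_(i <- r | P i) leavitt_mul x (F i).
Proof.
apply: (big_morph (leavitt_mul x)); first by move=> ? ?; rewrite leavitt_mulDr.
by apply: (@addrI _ (leavitt_mul x 0)); rewrite -leavitt_mulDr !addr0.
Qed.

Let lmul0l x : leavitt_mul 0 x = 0.
Proof. by have := lmulSl [::] predT (fun i : nat => x) x; rewrite !big_nil. Qed.

Let lmul0r x : leavitt_mul x 0 = 0.
Proof. by have := lmulSr [::] predT (fun i : nat => x) x; rewrite !big_nil. Qed.

Let mulvv v w : leavitt_mul (lpa_cls (lvert v)) (lpa_cls (lvert w)) =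
  if v == w then lpa_cls (lvert v) else 0.
Proof.
rewrite leavitt_mulE -[0]/(lpa_cls lzero) -fun_if.
exact/lpa_eqP/lpa_vv.
Qed.

Let one_v v x : leavitt_mul (lpa_cls (lvert v)) x = x ->
  leavitt_mul leavitt_one x = x.
Proof.
move=> e; rewrite -e leavitt_mulA lmulSl; congr (leavitt_mul _ x).
rewrite (bigD1 v) //= mulvv eqxx big1 ?addr0 // => w /negPf wv.
by rewrite mulvv wv.
Qed.

Let v_one v x : leavitt_mul x (lpa_cls (lvert v)) = x ->
  leavitt_mul x leavitt_one = x.
Proof.
move=> e; rewrite -e -leavitt_mulA lmulSr; congr (leavitt_mul x _).
rewrite (bigD1 v) //= mulvv eqxx big1 ?addr0 // => w /negPf wv.
by rewrite mulvv eq_sym wv.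
Qed.

Let lmulNr x y : leavitt_mul x (- y) = - leavitt_mul x y.
Proof. by apply: (@addrI _ (leavitt_mul x y)); rewrite -leavitt_mulDr !subrr lmul0r. Qed.

Let lmulNl x y : leavitt_mul (- x) y = - leavitt_mul x y.
Proof. by apply: (@addrI _ (leavitt_mul x y)); rewrite -leavitt_mulDl !subrr lmul0l. Qed.

Fact leavitt_scaleAl a x y :
  leavitt_scale a (leavitt_mul x y) = leavitt_mul (leavitt_scale a x) y.
Proof.
elim/lpa_ind: x => t; elim/lpa_ind: y => u.
by rewrite !(leavitt_mulE, leavitt_scaleE); apply/lpa_eqP/lpa_scaleAl.
Qed.

Fact leavitt_scaleAr a x y :
  leavitt_scale a (leavitt_mul x y) = leavitt_mul x (leavitt_scale a y).
Proof.
elim/lpa_ind: x => t; elim/lpa_ind: y => u.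
by rewrite !(leavitt_mulE, leavitt_scaleE); apply/lpa_eqP/lpa_scaleAr.
Qed.

Fact leavitt_mul1 : left_id leavitt_one leavitt_mul.
Proof.
elim/lpa_ind; elim=> [v|a|a||t IH|t IHt u IHu|a t IH|t IHt u IHu].
- by apply: (one_v (v := v)); rewrite mulvv eqxx.
- by apply: (one_v (v := src a)); rewrite leavitt_mulE; apply/lpa_eqP/lpa_se.
- by apply: (one_v (v := rng a)); rewrite leavitt_mulE; apply/lpa_eqP/lpa_rg.
- exact: lmul0r.
- by rewrite -leavitt_oppE lmulNr IH.
- by rewrite -leavitt_addE leavitt_mulDr IHt IHu.
- by rewrite -leavitt_scaleE -leavitt_scaleAr IH.
- by rewrite -leavitt_mulE leavitt_mulA IHt.
Qed.

Fact leavitt_mulr1 : right_id leavitt_one leavitt_mul.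
Proof.
elim/lpa_ind; elim=> [v|a|a||t IH|t IHt u IHu|a t IH|t IHt u IHu].
- by apply: (v_one (v := v)); rewrite mulvv eqxx.
- by apply: (v_one (v := rng a)); rewrite leavitt_mulE; apply/lpa_eqP/lpa_er.
- by apply: (v_one (v := src a)); rewrite leavitt_mulE; apply/lpa_eqP/lpa_gs.
- exact: lmul0l.
- by rewrite -leavitt_oppE lmulNl IH.
- by rewrite -leavitt_addE leavitt_mulDl IHt IHu.
- by rewrite -leavitt_scaleE -leavitt_scaleAl IH.
- by rewrite -leavitt_mulE -leavitt_mulA IHu.
Qed.

HB.instance Definition _ := GRing.Zmodule_isPzRing.Build leavitt
  leavitt_mulA leavitt_mul1 leavitt_mulr1 leavitt_mulDl leavitt_mulDr.

Fact leavitt_scaleA a b x :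
  leavitt_scale a (leavitt_scale b x) = leavitt_scale (a * b) x.
Proof.
by elim/lpa_ind: x => t; rewrite !leavitt_scaleE; apply/lpa_eqP/lpa_scaleA.
Qed.

Fact leavitt_scale1 : left_id 1 leavitt_scale.
Proof.
by elim/lpa_ind=> t; rewrite !leavitt_scaleE; apply/lpa_eqP/lpa_scale1.
Qed.

Fact leavitt_scaleDr : right_distributive leavitt_scale +%R.
Proof.
move=> a; elim/lpa_ind=> t; elim/lpa_ind=> u.
rewrite [lpa_cls t + _]leavitt_addE !leavitt_scaleE [RHS]leavitt_addE.
exact/lpa_eqP/lpa_scaleDr.
Qed.

Fact leavitt_scaleDl x : {morph leavitt_scale^~ x : a b / a + b}.
Proof.
elim/lpa_ind: x => t a b.
by rewrite !leavitt_scaleE [RHS]leavitt_addE; apply/lpa_eqP/lpa_scaleDl.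
Qed.

HB.instance Definition _ := GRing.Zmodule_isLmodule.Build K leavitt
  leavitt_scaleA leavitt_scale1 leavitt_scaleDr leavitt_scaleDl.
(* algType K requires 1 != 0, which fails when E has no vertex. *)
Lemma leavitt_scalerAl (a : K) (x y : leavitt) : a *: (x * y) = (a *: x) * y.
Proof. exact: leavitt_scaleAl. Qed.

Lemma leavitt_scalerAr (a : K) (x y : leavitt) : a *: (x * y) = x * (a *: y).
Proof. exact: leavitt_scaleAr. Qed.

Definition lpa_vert (v : vertex E) : leavitt := lpa_cls (lvert v).
Definition lpa_edge (a : edge E) : leavitt := lpa_cls (ledge a).
Definition lpa_ghost (a : edge E) : leavitt := lpa_cls (lghost a).

(* The least family of K-subspaces closed under products that contains the
   generators in degrees 0, 1 and -1; leavitt_grading shows it is a grading. *)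
Inductive leavitt_comp : int -> set leavitt :=
| comp_vert v : leavitt_comp 0 (lpa_vert v)
| comp_edge a : leavitt_comp 1 (lpa_edge a)
| comp_ghost a : leavitt_comp (- 1) (lpa_ghost a)
| comp_zero k : leavitt_comp k 0
| comp_add k x y : leavitt_comp k x -> leavitt_comp k y -> leavitt_comp k (x + y)
| comp_scale k a x : leavitt_comp k x -> leavitt_comp k (a *: x)
| comp_mul i j x y : leavitt_comp i x -> leavitt_comp j y ->
    leavitt_comp (i + j) (x * y).

Lemma leavitt_ind (p : leavitt -> Prop) :
  (forall v, p (lpa_vert v)) -> (forall a, p (lpa_edge a)) ->
  (forall a, p (lpa_ghost a)) -> p 0 ->
  (forall x y, p x -> p y -> p (x + y)) -> (forall a x, p x -> p (a *: x)) ->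
  (forall x y, p x -> p y -> p (x * y)) -> forall x, p x.
Proof.
move=> pv pe pg p0 pD pZ pM; elim/lpa_ind.
elim=> // [t IH|t IHt u IHu|a t IH|t IHt u IHu].
- have -> : lpa_cls (lopp t) = - 1 *: lpa_cls t by rewrite scaleN1r -leavitt_oppE.
  exact: pZ.
- by rewrite -leavitt_addE; apply: pD.
- by rewrite -leavitt_scaleE; apply: pZ.
- by rewrite -leavitt_mulE; apply: pM.
Qed.

(* Left multiplication of t on the Laurent series over L(E), where each
   generator also shifts the exponent by its degree. *)
Fixpoint lpa_act (t : lpa_term) (f : int -> leavitt) (k : int) : leavitt :=
  match t with
  | lvert v => lpa_vert v * f k
  | ledge a => lpa_edge a * f (k - 1)
  | lghost a => lpa_ghost a * f (k + 1)
  | lzero => 0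
  | lopp t => - lpa_act t f k
  | ladd t u => lpa_act t f k + lpa_act u f k
  | lscale a t => a *: lpa_act t f k
  | lmul t u => lpa_act t (lpa_act u f) k
  end.

Lemma lpa_act_ext t f g : f =1 g -> lpa_act t f =1 lpa_act t g.
Proof. by move=> fg; rewrite (funext fg). Qed.

Lemma lpa_actD t f g k :
  lpa_act t (fun i => f i + g i) k = lpa_act t f k + lpa_act t g k.
Proof.
elim: t f g k => [v|a|a||t IH|t IHt u IHu|a t IH|t IHt u IHu] f g k /=.
- by rewrite mulrDr.
- by rewrite mulrDr.
- by rewrite mulrDr.
- by rewrite addr0.
- by rewrite IH opprD.
- by rewrite IHt IHu addrACA.
- by rewrite IH scalerDr.
- by rewrite -IHt; apply: lpa_act_ext => i; apply: IHu.
Qed.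

Lemma lpa_actZ t c f k : lpa_act t (fun i => c *: f i) k = c *: lpa_act t f k.
Proof.
elim: t f k => [v|a|a||t IH|t IHt u IHu|a t IH|t IHt u IHu] f k /=.
- by rewrite leavitt_scalerAr.
- by rewrite leavitt_scalerAr.
- by rewrite leavitt_scalerAr.
- by rewrite scaler0.
- by rewrite IH scalerN.
- by rewrite IHt IHu scalerDr.
- by rewrite IH !scalerA mulrC.
- by rewrite -IHt; apply: lpa_act_ext => i; apply: IHu.
Qed.

Let relE t u x : lpa_rel (lmul t u) x -> lpa_cls t * lpa_cls u = lpa_cls x.
Proof. by move=> h; rewrite [LHS]leavitt_mulE; apply/lpa_eqP. Qed.

Lemma lpa_vvE v w : lpa_vert v * lpa_vert w = if v == w then lpa_vert v else 0.
Proof. exact: mulvv. Qed.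

Lemma lpa_seE a : lpa_vert (src a) * lpa_edge a = lpa_edge a.
Proof. exact/relE/lpa_se. Qed.

Lemma lpa_erE a : lpa_edge a * lpa_vert (rng a) = lpa_edge a.
Proof. exact/relE/lpa_er. Qed.

Lemma lpa_rgE a : lpa_vert (rng a) * lpa_ghost a = lpa_ghost a.
Proof. exact/relE/lpa_rg. Qed.

Lemma lpa_gsE a : lpa_ghost a * lpa_vert (src a) = lpa_ghost a.
Proof. exact/relE/lpa_gs. Qed.

Lemma lpa_geE a b :
  lpa_ghost a * lpa_edge b = if a == b then lpa_vert (rng a) else 0.
Proof. by rewrite (relE (lpa_ge a b)); case: ifP. Qed.

Lemma lpa_egE v : (exists a, src a = v) ->
  \sum_(a : edge E | src a == v) lpa_edge a * lpa_ghost a = lpa_vert v.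
Proof.
move=> /lpa_eg/lpa_eqP e; rewrite -[RHS]e lpa_cls_sum; apply: eq_bigr => a _.
exact: leavitt_mulE.
Qed.

Lemma lpa_actP t u : lpa_rel t u -> forall f, lpa_act t f =1 lpa_act u f.
Proof.
elim=> {t u} //=.
- by move=> t u _ h f k; rewrite h.
- by move=> t u w _ h1 _ h2 f k; rewrite h1 h2.
- by move=> t u _ h f k; rewrite h.
- by move=> t t' u u' _ h1 _ h2 f k; rewrite h1 h2.
- by move=> a t u _ h f k; rewrite h.
- by move=> t t' u u' _ h1 _ h2 f k; rewrite h1; apply: lpa_act_ext => i; apply: h2.
- by move=> t u w f k; rewrite addrA.
- by move=> t u f k; rewrite addrC.
- by move=> t f k; rewrite add0r.
- by move=> t f k; rewrite addNr.
- by move=> a b t f k; rewrite scalerA.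
- by move=> t f k; rewrite scale1r.
- by move=> a t u f k; rewrite scalerDr.
- by move=> a b t f k; rewrite scalerDl.
- by move=> t u w f k; rewrite -lpa_actD.
- by move=> a t u f k; rewrite -lpa_actZ.
- by move=> v w f k; rewrite mulrA lpa_vvE; case: ifP => //= _; rewrite mul0r.
- by move=> a f k; rewrite mulrA lpa_seE.
- by move=> a f k; rewrite mulrA lpa_erE.
- by move=> a f k; rewrite mulrA lpa_rgE.
- by move=> a f k; rewrite mulrA lpa_gsE.
- by move=> a b f k; rewrite mulrA lpa_geE addrK; case: ifP => //= _; rewrite mul0r.
- move=> v hv f k; rewrite -(lpa_egE hv) mulr_suml.
  elim/big_rec2: _ => //= a x t _ ->.
  by rewrite subrK mulrA.
Qed.

Definition lact (x : leavitt) (f : int -> leavitt) : int -> leavitt :=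
  lpa_act (repr x) f.

Lemma lactE t f : lact (lpa_cls t) f =1 lpa_act t f.
Proof. exact/lpa_actP/lpa_reprP. Qed.

Lemma lact0 f k : lact 0 f k = 0.
Proof. exact: lactE. Qed.

Lemma lactD x y f k : lact (x + y) f k = lact x f k + lact y f k.
Proof.
elim/lpa_ind: x => t; elim/lpa_ind: y => u.
by rewrite [_ + lpa_cls _]leavitt_addE !lactE.
Qed.

Lemma lact_comp d x f k : leavitt_comp d x -> lact x f k = x * f (k - d).
Proof.
move=> h; elim: h f k => {d x} [v|a|a|d|d x y _ IHx _ IHy|d a x _ IH|i j x y _ IHx _ IHy] f k.
- by rewrite lactE subr0.
- by rewrite lactE.
- by rewrite lactE opprK.
- by rewrite lact0 mul0r.
- by rewrite lactD IHx IHy mulrDl.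
- rewrite -leavitt_scalerAl -IH; elim/lpa_ind: x {IH} => t.
  by rewrite [_ *: _]leavitt_scaleE !lactE.
- have -> : lact (x * y) f k = lact x (lact y f) k.
    elim/lpa_ind: x {IHx} => t; elim/lpa_ind: y {IHy} => u.
    rewrite [_ * _]leavitt_mulE !lactE /=.
    by apply: lpa_act_ext => l; rewrite lactE.
  by rewrite IHx IHy mulrA opprD addrA.
Qed.

Lemma leavitt_grading : is_grading leavitt_comp.
Proof.
split.
- by move=> k; apply: comp_zero.
- by move=> k x y hx hy; rewrite -scaleN1r; apply: comp_add => //; apply: comp_scale.
- have g1 k x : leavitt_comp k x -> exists s : seq leavitt,
      (forall x, x \in s -> exists k, leavitt_comp k x) /\ x = \sum_(x <- s) x.
    move=> h; exists [:: x]; rewrite big_seq1; split=> // y.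
    by rewrite inE => /eqP ->; exists k.
  elim/leavitt_ind.
  + by move=> v; apply: g1 (comp_vert v).
  + by move=> v; apply: g1 (comp_edge v).
  + by move=> v; apply: g1 (comp_ghost v).
  + exact: g1 (comp_zero 0).
  + move=> x y [s [hs ->]] [t [ht ->]]; exists (s ++ t); rewrite big_cat.
    by split=> // z; rewrite mem_cat => /orP[/hs|/ht].
  + move=> a x [s [hs ->]]; exists [seq a *: y | y <- s].
    rewrite big_map scaler_sumr; split=> // z /mapP[y /hs[k hk] ->].
    by exists k; apply: comp_scale.
  + move=> x y [s [hs ->]] [t [ht ->]]; exists [seq u * w | u <- s, w <- t].
    split.
      move=> z /allpairsP[[u w] [/hs[i hi] /ht[j hj] ->]].
      by exists (i + j); apply: comp_mul.
    rewrite big_allpairs_dep mulr_suml; apply: eq_bigr => u _.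
    by rewrite mulr_sumr.
- move=> S f uS hf s0 k kS.
  pose d0 : int -> leavitt := fun i => if i == 0 then 1 else 0.
  have : lact (\sum_(i <- S) f i) d0 k = 0 by rewrite s0 lact0.
  rewrite (big_morph (fun x => lact x d0 k)
    (fun x y => lactD x y d0 k) (lact0 d0 k)).
  rewrite (bigD1_seq k) //= (lact_comp _ _ (hf k)) subrr /d0 eqxx mulr1.
  rewrite big1 ?addr0 // => i ik; rewrite (lact_comp _ _ (hf i)).
  by rewrite subr_eq0 eq_sym (negPf ik) mulr0.
Qed.

Lemma leavitt_comp_one : leavitt_comp 0 1.
Proof.
rewrite -[1]/leavitt_one /leavitt_one.
apply: (big_ind (leavitt_comp 0)) => [|x y|v _]; first exact: comp_zero.
  exact: comp_add.
exact: comp_vert.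
Qed.

Definition leavitt_path_algebra : gradedRing :=
  GradedRing leavitt_grading leavitt_comp_one comp_mul.

End Leavitt.

(* Main.v *)
From HB Require Import structures.
Require Import Defs.
From mathcomp Require Import all_boot all_order all_algebra fingroup perm.
From mathcomp Require Import boolp classical_sets zify.

Set Implicit Arguments.
Unset Strict Implicit.
Unset Printing Implicit Defensive.

Import GRing.Theory.
Local Open Scope ring_scope.

(** Let L be the Leavitt path algebra.  For a vertex v the relation
    v = sum of a a^* over the edges a leaving v splits the right ideal vL as the
    direct sum of the submodules aL, and a y |-> y identifies aL with r(a)L(-1).
    Hence x[vL] is the sum of the [r(a)L], which is how A^t acts on the basis
    vectors, and the classes [vL(-k)] should generate the direct limit, with
    [vL(-k)] sitting at stage k.  The proof turns this into a dimension theory for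
    graded modules, staying inside L instead of passing to its degree zero part.

    A basis of degree k of a graded module P is a finite family b_j in P_k with
    b_j w_j = b_j for vertices w_j, such that P is the direct sum of the b_j L and
    each b_j L is a copy of w_j L(-k).  Its rank is the function u that counts the
    j with w_j = v.  Replacing every b_j by the b_j a, for a leaving w_j, gives a
    basis of degree k + 1 and rank A^t u (has_rank_step): this is the transition
    map of the direct system.  Three facts make (k, u) |-> class of u at stage k a
    complete additive invariant of graded finitely generated projective modules:
    each of them has a basis of some natural degree (has_rank_ex); two ranks of one
    module in one degree agree after enough refinements (has_rank_unique); a degree
    and a rank determine the module (has_rank_iso), and all of them occur
    (has_rank_realize).  Shifting by 1 lowers the degree of a basis by 1, which is
    multiplication by A^t in the limit.  As the invariant takes values in a group,
    isomorphism classes cancel, and the group completion maps isomorphically onto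
    the dimension group, the classes of modules onto its positive cone.

    Both has_rank_ex and has_rank_unique rest on one property of L: given finitely
    many elements x of degree 0, there is a length h such that p^* x q is a
    K-combination of vertices for all paths p, q of length h
    (compressed_deg0_family).  Refining a family h times replaces a matrix with
    entries x by the matrix with entries p^* x q, so matrices over the degree zero
    part of L become block matrices over the field K.  For uniqueness, the two
    matrices of a change of basis become mutually inverse block matrices over K,
    and the sizes of the blocks must agree; this uses that vertices are nonzero in
    L, which is seen on the representation of L on the functions of infinite paths,
    which exist because there are no sinks.  For existence, projectivity provides
    homogeneous generators whose relations are governed by an idempotent matrix of
    degree zero; once that matrix has entries in K, redundant generators can be
    eliminated one at a time as in linear algebra, and what remains is a basis. *)

(** * Homogeneous components and right actions *)

Section Components.
Variables (V : zmodType) (c : int -> set V).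
Hypothesis cg : is_grading c.

Lemma gradingD k x y : c k x -> c k y -> c k (x + y).
Proof.
move=> cx cy; rewrite -[y]opprK -(sub0r y).
by do 2![apply: (gradingB cg) => //]; apply: grading0 cg k.
Qed.

Lemma grading_sum k I (r : seq I) (P : pred I) (F : I -> V) :
  (forall i, P i -> c k (F i)) -> c k (\sum_(i <- r | P i) F i).
Proof.
move=> h; apply: (big_ind (c k)) => //; first exact: grading0 cg k.
exact: gradingD.
Qed.

(** Finite support is recorded by a duplicate-free list so that sums over two
    supports can be compared on their union. *)
Definition decomposition (v : V) (f : int -> V) : Prop :=
  (forall k, c k (f k)) /\ exists S : seq int,
    [/\ uniq S, forall k, k \notin S -> f k = 0 & v = \sum_(k <- S) f k].

Lemma sum_support (S T : seq int) (f : int -> V) : uniq S -> uniq T ->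
  {subset S <= T} -> (forall k, k \notin S -> f k = 0) ->
  \sum_(k <- T) f k = \sum_(k <- S) f k.
Proof.
move=> uS uT ST fS; rewrite (bigID [in S]) /= [X in _ + X]big1 ?addr0 => [|k /fS//].
rewrite -big_filter; apply: perm_big; apply: uniq_perm; rewrite ?filter_uniq //.
by move=> k; rewrite mem_filter; apply: andb_idr => /ST.
Qed.

Lemma decompositionB v w f g : decomposition v f -> decomposition w g ->
  decomposition (v - w) (fun k => f k - g k).
Proof.
move=> [cf [S [uS fS ->]]] [cg' [T [uT gT ->]]]; split.
  by move=> k; apply: gradingB cg _ _ _ (cf k) (cg' k).
have uU := undup_uniq (S ++ T); exists (undup (S ++ T)); split=> //.
  move=> k; rewrite mem_undup mem_cat negb_or => /andP[/fS -> /gT ->].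
  by rewrite subr0.
rewrite sumrB; congr (_ - _); symmetry; apply: sum_support => //.
  by move=> k kS; rewrite mem_undup mem_cat kS.
by move=> k kT; rewrite mem_undup mem_cat kT orbT.
Qed.

Lemma decomposition_hom k v : c k v ->
  decomposition v (fun i => if i == k then v else 0).
Proof.
move=> cv; split; first by move=> i; case: eqP => [->//|_]; apply: grading0 cg i.
exists [:: k]; split=> //; last by rewrite big_seq1 eqxx.
by move=> i; rewrite inE => /negPf ->.
Qed.

Lemma decomposition_unique v f g : decomposition v f -> decomposition v g ->
  f =1 g.
Proof.
move=> df dg; have [ch [S [uS hS]]] := decompositionB df dg.
rewrite subrr => /esym s0 k; apply/eqP; rewrite -subr_eq0; apply/eqP.
have [kS|] := boolP (k \in S); last exact: hS.
exact: (grading_indep cg uS ch s0).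
Qed.

Lemma decomposition_ex v : exists f, decomposition v f.
Proof.
have [s [hs ->]] := grading_span cg v.
have d0 : decomposition 0 (fun=> 0 : V).
  by split=> [k|]; [apply: grading0 cg k|exists [::]; rewrite big_nil].
elim: s hs => [|x s IH] hs; first by exists (fun=> 0); rewrite big_nil.
have [f df] : exists f, decomposition (\sum_(y <- s) y) f.
  by apply: IH => y ys; apply: hs; rewrite inE ys orbT.
have [k ck] := hs x (mem_head _ _); rewrite big_cons.
have := decompositionB (decomposition_hom ck) (decompositionB d0 df).
by rewrite sub0r opprK; eexists; eassumption.
Qed.

Definition hcomp (k : int) (v : V) : V := projT1 (cid (decomposition_ex v)) k.

Lemma hcomp_decomposition v : decomposition v (hcomp^~ v).
Proof. by rewrite /hcomp; case: cid. Qed.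

Lemma hcompE v f k : decomposition v f -> hcomp k v = f k.
Proof. by move=> df; rewrite (decomposition_unique (hcomp_decomposition v) df k). Qed.

Lemma hcompP k v : c k (hcomp k v).
Proof. by have [] := hcomp_decomposition v. Qed.

Lemma hcomp_hom j k v : c k v -> hcomp j v = if j == k then v else 0.
Proof. by move=> /decomposition_hom/hcompE ->. Qed.

Lemma hcomp_id k v : c k v -> hcomp k v = v.
Proof. by move=> /hcomp_hom ->; rewrite eqxx. Qed.

Lemma hcomp0 k : hcomp k 0 = 0.
Proof. exact/hcomp_id/(grading0 cg). Qed.

Lemma hcompB k v w : hcomp k (v - w) = hcomp k v - hcomp k w.
Proof.
by apply: hcompE (decompositionB (hcomp_decomposition v) (hcomp_decomposition w)).
Qed.

Lemma hcompD k v w : hcomp k (v + w) = hcomp k v + hcomp k w.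
Proof. by rewrite -{1}[w]opprK hcompB -(sub0r w) hcompB hcomp0 sub0r opprK. Qed.

Lemma hcomp_sum k I (r : seq I) (P : pred I) (F : I -> V) :
  hcomp k (\sum_(i <- r | P i) F i) = \sum_(i <- r | P i) hcomp k (F i).
Proof. exact: (big_morph _ (hcompD k) (hcomp0 k)). Qed.

Lemma hcomp_eq0 v : (forall k, hcomp k v = 0) -> v = 0.
Proof.
move=> h; have [_ [S [_ _ ->]]] := hcomp_decomposition v.
by apply: big1 => k _; apply: h.
Qed.
End Components.

(** All the compatibilities of homogeneous components with products come from
    this one: multiplication by a homogeneous element is additive and translates
    degrees. *)
Lemma hcomp_additive (V W : zmodType) (c : int -> set V) (d : int -> set W)
    (cg : is_grading c) (dg : is_grading d) (f : V -> W) (i : int) :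
  f 0 = 0 -> {morph f : x y / x + y} ->
  (forall k v, c k v -> d (k + i) (f v)) ->
  forall k v, hcomp dg (k + i) (f v) = f (hcomp cg k v).
Proof.
move=> f0 fD fc k v; have [cv [S [uS vS e]]] := hcomp_decomposition cg v.
rewrite (hcompE _ (f := fun j => f (hcomp cg (j - i) v))); first by rewrite addrK.
split=> [j|]; first by rewrite -{1}[j](subrK i); apply/fc/cv.
exists [seq j + i | j <- S]; split.
- by rewrite map_inj_uniq //; apply: addIr.
- move=> j jS; rewrite vS //; apply: contra jS => jS.
  by apply/mapP; exists (j - i); rewrite // subrK.
- rewrite {1}e (big_morph f fD f0) big_map; apply: eq_bigr => j _.
  by rewrite addrK.
Qed.

Section RightAction.
Variable B : gradedRing.

(** Scaling by the converse ring multiplies on the other side; all computations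
    with right modules are phrased with this action and products of B itself. *)
Definition ract (M : lmodType B^c) (m : M) (x : B) : M := (x : B^c) *: m.

Local Infix "|>" := ract (at level 40, left associativity).

Section Theory.
Variable M : lmodType B^c.
Implicit Types (m : M) (x y : B).

Lemma ractM m x y : m |> (x * y) = m |> x |> y.
Proof. by rewrite /ract scalerA. Qed.

Lemma ract1 m : m |> 1 = m. Proof. exact: scale1r. Qed.
Lemma ract0 m : m |> 0 = 0. Proof. exact: scale0r. Qed.
Lemma ract0l x : (0 : M) |> x = 0. Proof. exact: scaler0. Qed.
Lemma ractDr m x y : m |> (x + y) = m |> x + m |> y. Proof. exact: scalerDl. Qed.
Lemma ractBr m x y : m |> (x - y) = m |> x - m |> y. Proof. exact: scalerBl. Qed.
Lemma ractDl m n x : (m + n) |> x = m |> x + n |> x. Proof. exact: scalerDr. Qed.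

Lemma ract_sumr m I (r : seq I) (P : pred I) (F : I -> B) :
  m |> (\sum_(i <- r | P i) F i) = \sum_(i <- r | P i) m |> F i.
Proof. exact: (big_morph (ract m) (ractDr m) (ract0 m)). Qed.

Lemma ract_suml x I (r : seq I) (P : pred I) (F : I -> M) :
  (\sum_(i <- r | P i) F i) |> x = \sum_(i <- r | P i) F i |> x.
Proof.
apply: (big_morph (fun m : M => m |> x)) => [m n|]; first exact: ractDl.
exact: ract0l.
Qed.
End Theory.

Lemma linear_ract (M N : lmodType B^c) (f : {linear M -> N}) m x :
  f (m |> x) = f m |> x.
Proof. exact: linearZ. Qed.

Lemma linear_of_ract (M N : lmodType B^c) (f : M -> N) :
  (forall m n, f (m + n) = f m + f n) -> (forall m x, f (m |> x) = f m |> x) ->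
  exists h : {linear M -> N}, h =1 f.
Proof. by move=> fD fZ; apply: linear_ex => a m n; rewrite fD; congr (_ + _); apply: fZ. Qed.

Variable P : grModule B.

Lemma ract_deg i j (m : P) (x : B) : gm_comp i m -> gr_comp j x ->
  gm_comp (i + j) (m |> x).
Proof. exact: gm_act. Qed.

Definition mcomp k (m : P) : P := hcomp (gm_grading P) k m.
Definition rcomp k (x : B) : B := hcomp (gr_grading B) k x.

Lemma mcomp_ractl i k (m : P) (x : B) : gm_comp i m ->
  mcomp (k + i) (m |> x) = m |> rcomp k x.
Proof.
move=> mi; apply: (hcomp_additive (gr_grading B) (gm_grading P) (f := ract m)).
- exact: ract0.
- exact: ractDr.
- by move=> j y yj; rewrite addrC; apply: ract_deg.
Qed.

Lemma mcomp_sum k I (r : seq I) (Q : pred I) (F : I -> P) :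
  mcomp k (\sum_(i <- r | Q i) F i) = \sum_(i <- r | Q i) mcomp k (F i).
Proof. exact: hcomp_sum. Qed.

Lemma mcomp_id k (m : P) : gm_comp k m -> mcomp k m = m.
Proof. exact: hcomp_id. Qed.

End RightAction.

Section RingComponents.
Variable B : gradedRing.

Lemma rcompP k (x : B) : gr_comp k (rcomp k x).
Proof. exact: hcompP. Qed.

Lemma rcomp_sum k I (r : seq I) (Q : pred I) (F : I -> B) :
  rcomp k (\sum_(i <- r | Q i) F i) = \sum_(i <- r | Q i) rcomp k (F i).
Proof. exact: hcomp_sum. Qed.

Lemma rcomp0 k : rcomp k (0 : B) = 0.
Proof. exact: hcomp0. Qed.

Lemma rcomp_eq0 (x : B) : (forall k, rcomp k x = 0) -> x = 0.
Proof. exact: hcomp_eq0. Qed.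

Lemma rcomp_mull i k (x y : B) : gr_comp i x ->
  rcomp (k + i) (x * y) = x * rcomp k y.
Proof.
move=> xi; apply: (hcomp_additive (gr_grading B) (gr_grading B) (f := *%R x)).
- exact: mulr0.
- exact: mulrDr.
- by move=> j z zj; rewrite addrC; apply: gr_mul.
Qed.

Lemma rcomp_mulr i k (x y : B) : gr_comp i y ->
  rcomp (k + i) (x * y) = rcomp k x * y.
Proof.
move=> yi.
apply: (hcomp_additive (gr_grading B) (gr_grading B) (f := fun x : B => x * y)).
- exact: mul0r.
- by move=> x1 x2; apply: mulrDl.
- by move=> j z zj; apply: gr_mul.
Qed.
End RingComponents.

(** * The Leavitt relations and nonvanishing of the vertices *)

(* Otherwise simplification replaces the graded ring by its carrier and the
   lemmas on graded rings stop matching. *)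
Local Arguments gr_ring : simpl never.
Local Infix "|>" := ract (at level 40, left associativity).

Section Relations.
Variables (K : fieldType) (E : finDigraph).

Local Notation V := (vertex E).
Local Notation L := (leavitt_path_algebra K E).

Definition vtx (v : V) : L := lpa_vert K v.
Definition edg (a : edge E) : L := lpa_edge K a.
Definition gho (a : edge E) : L := lpa_ghost K a.
Definition scl (c : K) : L := (c *: (1 : leavitt K E)).

Lemma vtx_vtx v w : vtx v * vtx w = if v == w then vtx v else 0.
Proof. exact: lpa_vvE. Qed.

Lemma vtxK v : vtx v * vtx v = vtx v.
Proof. by rewrite vtx_vtx eqxx. Qed.

Lemma src_edg a : vtx (src a) * edg a = edg a. Proof. exact: lpa_seE. Qed.
Lemma edg_rng a : edg a * vtx (rng a) = edg a. Proof. exact: lpa_erE. Qed.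
Lemma rng_gho a : vtx (rng a) * gho a = gho a. Proof. exact: lpa_rgE. Qed.
Lemma gho_src a : gho a * vtx (src a) = gho a. Proof. exact: lpa_gsE. Qed.

Lemma gho_edg a b : gho a * edg b = if a == b then vtx (rng a) else 0.
Proof. exact: lpa_geE. Qed.

Lemma vtx_edg v a : vtx v * edg a = if v == src a then edg a else 0.
Proof. by rewrite -src_edg mulrA vtx_vtx; case: eqP => [->//|_]; rewrite mul0r. Qed.

Lemma sum_vtx : 1 = \sum_v vtx v :> L. Proof. by []. Qed.

Lemma scl0 : scl 0 = 0. Proof. exact: scale0r. Qed.
Lemma scl1 : scl 1 = 1. Proof. exact: scale1r. Qed.
Lemma sclD c d : scl (c + d) = scl c + scl d. Proof. exact: scalerDl. Qed.

Lemma sclE c (x : L) : scl c * x = (c *: (x : leavitt K E)).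
Proof.
transitivity (c *: (1 * x : leavitt K E)); last by rewrite mul1r.
by symmetry; apply: leavitt_scalerAl.
Qed.

Lemma scl_comm c (x : L) : scl c * x = x * scl c.
Proof.
rewrite sclE; transitivity (c *: (x * 1 : leavitt K E)); first by rewrite mulr1.
exact: leavitt_scalerAr.
Qed.

Lemma sclM c d : scl (c * d) = scl c * scl d.
Proof. by rewrite sclE /scl scalerA. Qed.

Lemma deg_vtx v : gr_comp 0 (vtx v). Proof. exact: comp_vert. Qed.
Lemma deg_edg a : gr_comp 1 (edg a). Proof. exact: comp_edge. Qed.
Lemma deg_gho a : gr_comp (- 1) (gho a). Proof. exact: comp_ghost. Qed.

(** Induction on homogeneous elements, with scalars as ring elements. *)
Lemma leavitt_comp_ind (p : int -> L -> Prop) :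
  (forall v, p 0 (vtx v)) -> (forall a, p 1 (edg a)) -> (forall a, p (- 1) (gho a)) ->
  (forall k, p k 0) -> (forall k x y, p k x -> p k y -> p k (x + y)) ->
  (forall k c x, p k x -> p k (scl c * x)) ->
  (forall i j x y, p i x -> p j y -> p (i + j) (x * y)) ->
  forall k (x : L), gr_comp k x -> p k x.
Proof.
move=> pv pe pg p0 pD pZ pM k x; elim=> {k x} //.
- by move=> k x y _ px _ py; apply: pD.
- by move=> k c x _ px; rewrite -sclE; apply: pZ.
- by move=> i j x y _ px _ py; apply: pM.
Qed.

Section NoSinks.
Hypothesis no_sink : forall v : V, exists a : edge E, src a = v.

Lemma sum_edg_gho v : \sum_(a | src a == v) edg a * gho a = vtx v.
Proof. exact: lpa_egE. Qed.

Lemma sum_edges : \sum_a edg a * gho a = 1.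
Proof.
rewrite sum_vtx (partition_big (@src E) predT) //=.
by apply: eq_bigr => v _; rewrite sum_edg_gho.
Qed.

Let path : Type := nat -> edge E.

Definition valid (x : path) : Prop := forall n, src (x n.+1) = rng (x n).
Definition pcons (a : edge E) (x : path) : path :=
  fun n => if n is m.+1 then x m else a.
Definition ptail (x : path) : path := fun n => x n.+1.

(** L acts on the K-valued functions of infinite paths: an edge a prolongs a path
    by a, so that (a f)(a x) = f(x) and a f vanishes at the other paths, while
    (a^* f)(x) = f(a x) if x starts at r(a), and 0 otherwise.  Functions are defined on all sequences of edges and
    cut off to vanish outside the valid ones. *)
Fixpoint interp (t : lpa_term K E) (f : path -> K) (x : path) : K :=
  match t with
  | lvert v => if `[< valid x >] && (src (x 0) == v) then f x else 0
  | ledge a => if `[< valid x >] && (x 0 == a) then f (ptail x) else 0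
  | lghost a => if `[< valid x >] && (src (x 0) == rng a) then f (pcons a x) else 0
  | lzero => 0
  | lopp t => - interp t f x
  | ladd t u => interp t f x + interp u f x
  | lscale c t => c * interp t f x
  | lmul t u => interp t (interp u f) x
  end.

(** Linearity of the operators is what makes interp respect distributivity of
    products and their compatibility with scalars. *)
Lemma interp_lin t c f g : interp t (fun x => c * f x + g x) =
  (fun x => c * interp t f x + interp t g x).
Proof.
have h0 : c * 0 + 0 = 0 :> K by rewrite mulr0 addr0.
elim: t f g => [v|a|a||t IH|t IHt u IHu|d t IH|t IHt u IHu] f g;
  apply: funext => x /=; rewrite ?h0 //; try by case: ifP.
- by rewrite IH opprD mulrN.
- by rewrite IHt IHu mulrDr addrACA.
- by rewrite IH mulrDr !mulrA (mulrC d).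
- by rewrite IHu IHt.
Qed.

Lemma interp_sum (I : finType) (Q : pred I) (F : I -> lpa_term K E) f x :
  interp (\big[@ladd K E/@lzero K E]_(i | Q i) F i) f x = \sum_(i | Q i) interp (F i) f x.
Proof. by elim/big_rec2: _ => //= i y1 y2 _ ->. Qed.

Lemma valid_tail x : valid x -> valid (ptail x).
Proof. by move=> vx n; apply: vx. Qed.

Lemma valid_cons a x : valid x -> src (x 0%N) = rng a -> valid (pcons a x).
Proof. by move=> vx e [|n] //=; apply: vx. Qed.

Lemma pconsK x : pcons (x 0%N) (ptail x) = x.
Proof. by apply: funext => -[]. Qed.

Lemma interpP t u : lpa_rel t u -> interp t = interp u.
Proof.
move=> h; apply: funext => f; apply: funext => x.
elim: h f x => {t u} //=.
- by move=> t u w _ h1 _ h2 f k; rewrite h1 h2.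
- by move=> t u _ h f k; rewrite h.
- by move=> t t' u u' _ h1 _ h2 f k; rewrite h1 h2.
- by move=> a t u _ h f k; rewrite h.
- by move=> t t' u u' _ h1 _ h2 f x; rewrite h1; congr interp; apply: funext => y; apply: h2.
- by move=> t u w f k; rewrite addrA.
- by move=> t u f k; rewrite addrC.
- by move=> t f k; rewrite add0r.
- by move=> t f k; rewrite addNr.
- by move=> a b t f k; rewrite mulrA.
- by move=> t f k; rewrite mul1r.
- by move=> a t u f k; rewrite mulrDr.
- by move=> a b t f k; rewrite mulrDl.
- move=> t u w f x; have := interp_lin t 1 (interp u f) (interp w f).
  move/(congr1 (@^~ x)); rewrite mul1r => <-; congr interp.
  by apply: funext => y; rewrite mul1r.
- move=> a t u f x; have h0 : interp t (fun=> 0) x = 0.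
    have /(congr1 (@^~ x)) := interp_lin t (-1) (fun=> 0) (fun=> 0).
    rewrite (mulN1r (interp _ _ _)) addNr => e; rewrite -[RHS]e; congr interp.
    by apply: funext => y; rewrite mulr0 addr0.
  have /(congr1 (@^~ x)) := interp_lin t a (interp u f) (fun=> 0).
  rewrite h0 addr0 => <-; congr interp; apply: funext => y.
  by rewrite addr0.
- move=> v w f x; have [->|/eqP vw] /= := eqVneq v w; first by case: (_ && _).
  by case: ifP => // /andP[_ /eqP ->]; rewrite (introF eqP vw) andbF.
- move=> a f x; case: ifP => [/andP[/asboolP vx /eqP sx]|nx].
    by [].
  by case: ifP => // /andP[vx /eqP x0]; move: nx; rewrite vx x0 eqxx.
- move=> a f x; case: ifP => // /andP[/asboolP vx /eqP <-].
  by rewrite asboolT ?vx ?eqxx //; apply: valid_tail.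
- by move=> a f x; case: (_ && _).
- move=> a f x; case: ifP => // /andP[/asboolP vx /eqP e].
  by rewrite asboolT ?eqxx //; apply: valid_cons.
- move=> a b f x; case: ifP => [/andP[/asboolP vx /eqP e]|ne].
    rewrite asboolT /=; last exact: valid_cons.
    case: eqP => [_|//] /=.
    by rewrite (_ : ptail _ = x) // asboolT // e eqxx.
  by case: eqP => //= _; rewrite ne.
- move=> v _ f x; rewrite interp_sum /=.
  case: ifP => [/andP[/asboolP vx /eqP e]|nx].
    rewrite (bigD1 (x 0%N)) /=; last by rewrite e.
    rewrite !asboolT //= ?eqxx; last exact: valid_tail.
    rewrite vx eqxx pconsK big1 ?addr0 // => a /andP[_ /negPf ax].
    by rewrite [x 0%N == a]eq_sym ax ?andbF.
  apply: big1 => a /eqP av; case: ifP => // /andP[vx /eqP xa].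
  by move: nx; rewrite vx xa av eqxx.
Qed.

Lemma valid_ex v : exists x, valid x /\ src (x 0%N) = v.
Proof.
pose nxt w := projT1 (cid (no_sink w)).
have nxtE w : src (nxt w) = w by rewrite /nxt; case: cid.
by exists (fun n => iter n (fun a => nxt (rng a)) (nxt v)); split=> [n|] /=.
Qed.

(** The vertex v fixes the value of a function at any infinite path starting at
    v; without sinks there is such a path. *)
Lemma scl_vtx_eq0 c v : scl c * vtx v = 0 -> c = 0.
Proof.
rewrite sclE [_ *: _]leavitt_scaleE => /lpa_eqP/interpP h.
have [x [vx xv]] := valid_ex v.
have := congr1 (fun F => F (fun=> 1) x) h.
by rewrite /= asboolT // xv eqxx mulr1.
Qed.

End NoSinks.
End Relations.

(** * Elements of degree zero are eventually diagonal *)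

Section Diagonalization.
Variables (K : fieldType) (E : finDigraph).
Hypothesis no_sink : forall v : vertex E, exists a : edge E, src a = v.

Local Notation V := (vertex E).
Local Notation L := (leavitt_path_algebra K E).
Local Notation vtx := (@vtx K E).
Local Notation edg := (@edg K E).
Local Notation gho := (@gho K E).
Local Notation scl := (@scl K E).

Definition vdiagonal (x : L) : Prop :=
  exists c : V -> K, x = \sum_v scl (c v) * vtx v.

Lemma vdiagonalD x y : vdiagonal x -> vdiagonal y -> vdiagonal (x + y).
Proof.
move=> [c ->] [d ->]; exists (fun v => c v + d v); rewrite -big_split.
by apply: eq_bigr => v _; rewrite sclD mulrDl.
Qed.

Lemma vdiagonal0 : vdiagonal 0.
Proof. by exists (fun=> 0); rewrite big1 // => v _; rewrite scl0 mul0r. Qed.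

Lemma vdiagonalZ c x : vdiagonal x -> vdiagonal (scl c * x).
Proof.
move=> [d ->]; exists (fun v => c * d v); rewrite mulr_sumr.
by apply: eq_bigr => v _; rewrite sclM mulrA.
Qed.

Lemma vdiagonal_vtx v : vdiagonal (vtx v).
Proof.
exists (fun w => if w == v then 1 else 0); rewrite (bigD1 v) //= eqxx scl1 mul1r.
by rewrite big1 ?addr0 // => w /negPf ->; rewrite scl0 mul0r.
Qed.

Lemma vdiagonal_sum I (r : seq I) (Q : pred I) (F : I -> L) :
  (forall i, Q i -> vdiagonal (F i)) -> vdiagonal (\sum_(i <- r | Q i) F i).
Proof. exact: (big_ind vdiagonal vdiagonal0 vdiagonalD). Qed.

Lemma vdiagonalM x y : vdiagonal x -> vdiagonal y -> vdiagonal (x * y).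
Proof.
move=> [c ->] dy; rewrite mulr_suml; apply: vdiagonal_sum => v _.
rewrite -mulrA; apply: vdiagonalZ; case: dy => d ->.
rewrite mulr_sumr; apply: vdiagonal_sum => w _.
rewrite mulrA -scl_comm -mulrA vtx_vtx; apply: vdiagonalZ.
by case: ifP => _; [apply: vdiagonal_vtx|apply: vdiagonal0].
Qed.

Lemma vdiagonal_sandwich a b x : vdiagonal x -> vdiagonal (gho a * (x * edg b)).
Proof.
move=> [c ->]; rewrite mulr_suml mulr_sumr; apply: vdiagonal_sum => v _.
rewrite -mulrA mulrA -scl_comm -mulrA; apply: vdiagonalZ.
rewrite vtx_edg; case: ifP => _; last by rewrite mulr0; apply: vdiagonal0.
rewrite gho_edg; case: ifP => _; first exact: vdiagonal_vtx.
exact: vdiagonal0.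
Qed.

(** compressed m n x: for all paths p of length m and q of length n, the
    compression p^* x q is diagonal.  Letters are peeled off one at a time, the
    first letters of p and q innermost, those of p before those of q. *)
Fixpoint compressedr (n : nat) (x : L) : Prop :=
  if n is n'.+1 then forall b, compressedr n' (x * edg b) else vdiagonal x.

Fixpoint compressed (m n : nat) (x : L) : Prop :=
  if m is m'.+1 then forall a, compressed m' n (gho a * x) else compressedr n x.

Lemma compressedSr m n x : compressed m n.+1 x <-> forall b, compressed m n (x * edg b).
Proof.
elim: m x => [|m IH] x //=; split=> h.
  by move=> b a; rewrite mulrA; exact: (proj1 (IH _) (h a) b).
by move=> a; apply/IH => b; rewrite -mulrA.
Qed.

Lemma compressedD m n x y : compressed m n x -> compressed m n y -> compressed m n (x + y).
Proof.
elim: m x y => [|m IH] x y /=; last by move=> hx hy a; rewrite mulrDr; apply: IH.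
elim: n x y => [|n IH] x y /=; first exact: vdiagonalD.
by move=> hx hy b; rewrite mulrDl; apply: IH.
Qed.

Lemma compressed0 m n : compressed m n 0.
Proof.
elim: m => [|m IH] /=; last by move=> a; rewrite mulr0.
by elim: n => [|n IH] /=; [apply: vdiagonal0|move=> b; rewrite mul0r].
Qed.

Lemma compressedZ m n c x : compressed m n x -> compressed m n (scl c * x).
Proof.
elim: m x => [|m IH] x /=.
  elim: n x => [|n IH] x /=; first exact: vdiagonalZ.
  by move=> h b; rewrite -mulrA; apply: IH.
by move=> h a; rewrite mulrA -scl_comm -mulrA; apply: IH.
Qed.

(** The extra letters end up outermost, where they compress an element that is
    already diagonal, and diagonal elements are stable under compression. *)
Lemma compressedSS m n x : compressed m n x -> compressed m.+1 n.+1 x.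
Proof.
elim: m x => [|m IH] x; last by move=> h a; apply: IH.
elim: n x => [|n IH] x /= h a; last first.
  by move=> b; have := IH (x * edg b) (h b) a; rewrite /= mulrA.
by move=> b; rewrite -mulrA; apply: vdiagonal_sandwich.
Qed.

Lemma compressed_raise p m n x : compressed m n x -> compressed (m + p) (n + p) x.
Proof. by move=> h; elim: p => [|p IH]; rewrite ?addn0 // !addnS; apply: compressedSS. Qed.

(** Between the two factors the unit is inserted as the sum of the r r^* over the
    paths r of length n, which turns p^* x y q into a sum of products of
    compressions of x and of y. *)
Lemma compressedM m n l x y : compressed m n x -> compressed n l y -> compressed m l (x * y).
Proof.
elim: m x => [|m IH] x /=; last by move=> hx hy a; rewrite mulrA; apply: IH.
elim: l y => [|l IH] y hx.
  elim: n x y hx => [|n IH] x y /=; first exact: vdiagonalM.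
  move=> hx hy; rewrite -[y]mul1r -(sum_edges _ no_sink) mulr_suml mulr_sumr.
  apply: (big_ind (compressed 0 0)) => [||a _]; [exact: compressed0|exact: compressedD|].
  by rewrite -(mulrA (edg a)) (mulrA x); apply: IH; [apply: hx|apply: hy].
by move=> /compressedSr hy b; rewrite -mulrA; apply: IH.
Qed.

(** One letter on the left makes an edge diagonal, one letter on the right a ghost
    edge.  For sums and products the lengths have to match, and raising both
    lengths of an element keeps their difference, which is its degree. *)
Lemma compressed_deg k (x : L) : gr_comp k x ->
  exists m n : nat, (m%:Z - n%:Z = k) /\ compressed m n x.
Proof.
elim/leavitt_comp_ind => {k x}.
- by move=> v; exists 0%N, 0%N; split=> //; apply: vdiagonal_vtx.
- move=> a; exists 1%N, 0%N; split=> // b /=; rewrite gho_edg.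
  by case: ifP => _; [apply: vdiagonal_vtx|apply: vdiagonal0].
- move=> a; exists 0%N, 1%N; split=> // b /=; rewrite gho_edg.
  by case: ifP => _; [apply: vdiagonal_vtx|apply: vdiagonal0].
- move=> [k|k]; first by exists k, 0%N; split; [rewrite subr0|apply: compressed0].
  by exists 0%N, k.+1; split; [rewrite sub0r NegzE|apply: compressed0].
- move=> k x y [m [n [e hx]]] [m' [n' [e' hy]]].
  exists (m + m')%N, (n + m')%N; split; first by lia.
  apply: compressedD; first exact: compressed_raise.
  have -> : (m + m' = m' + m)%N by lia.
  have -> : (n + m' = n' + m)%N by lia.
  exact: compressed_raise.
- by move=> k c x [m [n [e hx]]]; exists m, n; split=> //; apply: compressedZ.
- move=> i j x y [m [n [e hx]]] [m' [n' [e' hy]]].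
  exists (m + m')%N, (n' + n)%N; split; first by lia.
  apply: (@compressedM _ (n + m')); first exact: compressed_raise.
  by rewrite addnC; apply: compressed_raise.
Qed.

Lemma compressed_deg0 (x : L) : gr_comp 0 x -> exists h, compressed h h x.
Proof.
by move=> /compressed_deg[m [n [e hx]]]; exists m; have e2 : m = n by [lia]; rewrite {2}e2.
Qed.

Lemma compressed_deg0_family (I : finType) (F : I -> L) :
  (forall i, gr_comp 0 (F i)) -> exists h, forall i, compressed h h (F i).
Proof.
move=> hF; have /choice[d hd] := fun i => compressed_deg0 (hF i).
exists (\max_i d i) => i.
by rewrite -(subnKC (leq_bigmax i : (d i <= _)%N)); apply: compressed_raise.
Qed.
End Diagonalization.

(** * Graded bases of modules *)

Section Bases.
Variables (K : fieldType) (E : finDigraph).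

Local Notation V := (vertex E).
Local Notation L := (leavitt_path_algebra K E).
Local Notation vtx := (@vtx K E).
Local Notation edg := (@edg K E).
Local Notation gho := (@gho K E).

(** The index set is a subset D of a finite type, so that generators can be thrown
    away and pairs (basis element, edge) filtered without changing the type.
    Freeness concerns w_j x_j only, since b_j x = b_j w_j x. *)
Record basis (P : grModule L) (k : int) (J : finType) (D : {set J})
    (w : J -> V) (b : J -> P) : Prop := Basis {
  basis_hom : forall j, j \in D -> gm_comp k (b j);
  basis_vtx : forall j, j \in D -> b j |> vtx (w j) = b j;
  basis_span : forall m, exists x : J -> L, m = \sum_(j in D) b j |> x j;
  basis_free : forall x : J -> L, \sum_(j in D) b j |> x j = 0 ->
    forall j, j \in D -> vtx (w j) * x j = 0
}.

Definition fibre_card (J : finType) (D : {set J}) (w : J -> V) (v : V) : nat :=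
  #|[set j in D | w j == v]|.

Definition has_rank (P : grModule L) (k : int) (u : V -> nat) : Prop :=
  exists (J : finType) (D : {set J}) (w : J -> V) (b : J -> P),
    basis k D w b /\ fibre_card D w =1 u.

Section OneBasis.
Variables (P : grModule L) (k : int) (J : finType) (D : {set J}).
Variables (w : J -> V) (b : J -> P).
Hypothesis bP : basis k D w b.

Lemma basis_vtxl j x : j \in D -> b j |> (vtx (w j) * x) = b j |> x.
Proof. by move=> jD; rewrite ractM (basis_vtx bP). Qed.

Lemma basis_coord m : exists x : J -> L,
  (forall j, vtx (w j) * x j = x j) /\ m = \sum_(j in D) b j |> x j.
Proof.
have [x ->] := basis_span bP m; exists (fun j => vtx (w j) * x j); split.
  by move=> j; rewrite mulrA vtxK.
by apply: eq_bigr => j jD; rewrite basis_vtxl.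
Qed.

Lemma basis_eq x y : \sum_(j in D) b j |> x j = \sum_(j in D) b j |> y j ->
  forall j, j \in D -> vtx (w j) * x j = vtx (w j) * y j.
Proof.
move=> e j jD; apply/eqP; rewrite -subr_eq0 -mulrBr; apply/eqP.
apply: (basis_free bP (x := fun j => x j - y j)) jD.
rewrite (eq_bigr (fun j => b j |> x j - b j |> y j)) => [|i _]; last exact: ractBr.
by rewrite sumrB e subrr.
Qed.

(** The homogeneous component of degree d - k of the coordinates are again
    coordinates of the same element, hence equal to them. *)
Lemma basis_coord_deg d x : gm_comp d (\sum_(j in D) b j |> x j) ->
  (forall j, vtx (w j) * x j = x j) ->
  forall j, j \in D -> gr_comp (d - k) (x j).
Proof.
move=> md wx j jD; rewrite -wx.
have -> : vtx (w j) * x j = vtx (w j) * rcomp (d - k) (x j).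
  apply: (basis_eq (y := fun j => rcomp (d - k) (x j))) jD.
  rewrite -{1}(mcomp_id md) mcomp_sum; apply: eq_bigr => i iD.
  by rewrite -{1}(subrK k d) mcomp_ractl //; apply: (basis_hom bP).
by rewrite -{1}[d - k]add0r; apply: gr_mul; [apply: deg_vtx|apply: rcompP].
Qed.

(** P is the direct sum of copies of the w_j L, so a linear map may be prescribed
    on a basis as soon as the images satisfy b'_j w_j = b'_j. *)
Lemma basis_map (Q : grModule L) (b' : J -> Q) :
  (forall j, j \in D -> b' j |> vtx (w j) = b' j) ->
  exists f : {linear P -> Q}, forall x : J -> L,
    f (\sum_(j in D) b j |> x j) = \sum_(j in D) b' j |> x j.
Proof.
move=> hb'; have /choice[c hc] := basis_span bP.
have fE x : \sum_(j in D) b' j |> c (\sum_(j in D) b j |> x j) j =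
    \sum_(j in D) b' j |> x j.
  apply: eq_bigr => j jD; have := basis_eq (esym (hc (\sum_(j in D) b j |> x j))) jD.
  by move=> e; rewrite -(hb' j jD) -!ractM e.
have [f hf] : exists f : {linear P -> Q}, f =1 (fun m => \sum_(j in D) b' j |> c m j).
  apply: linear_of_ract => [m n|m x].
    have e : m + n = \sum_(j in D) b j |> (c m j + c n j).
      rewrite {1}(hc m) {1}(hc n) -big_split; apply: eq_bigr => j _.
      by rewrite ractDr.
    rewrite e fE -big_split; apply: eq_bigr => j _.
    by rewrite ractDr.
  have e : m |> x = \sum_(j in D) b j |> (c m j * x).
    by rewrite {1}(hc m) ract_suml; apply: eq_bigr => j _; rewrite ractM.
  by rewrite e fE ract_suml; apply: eq_bigr => j _; rewrite ractM.
by exists f => x; rewrite hf fE.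
Qed.
End OneBasis.

(** The maps exchanging the two bases are inverse to each other; they preserve
    degrees since coordinates of homogeneous elements are homogeneous. *)
Lemma basis_iso (P Q : grModule L) k (J : finType) (D : {set J}) w
    (b : J -> P) (b' : J -> Q) :
  basis k D w b -> basis k D w b' -> gr_iso P Q.
Proof.
move=> bP bQ; have [f hf] := basis_map bP (basis_vtx bQ).
have [g hg] := basis_map bQ (basis_vtx bP).
have fdeg (R S : grModule L) (c : J -> R) (c' : J -> S) (h : {linear R -> S}) d m :
    basis k D w c -> basis k D w c' ->
    (forall x, h (\sum_(j in D) c j |> x j) = \sum_(j in D) c' j |> x j) ->
    gm_comp d m -> gm_comp d (h m).
  move=> bc bc' hE; have [x [wx ->]] := basis_coord bc m => md.
  rewrite hE; apply: (grading_sum (gm_grading S)) => j jD.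
  rewrite -(subrK k d) addrC; apply: ract_deg; first exact: (basis_hom bc').
  exact: basis_coord_deg md wx j jD.
have fK : cancel f g by move=> m; have [x ->] := basis_span bP m; rewrite hf hg.
have gK : cancel g f by move=> m; have [x ->] := basis_span bQ m; rewrite hg hf.
exists f; split; first by exists g.
move=> d m; split; first exact: fdeg bP bQ hf.
by move=> /(fdeg _ _ _ _ _ _ _ bQ bP hg); rewrite fK.
Qed.

Lemma basis_reindex (P : grModule L) k (J J' : finType) (D : {set J})
    (D' : {set J'}) w (b : J -> P) (h : J' -> J) :
  {in D' &, injective h} -> h @: D' = D -> basis k D w b ->
  basis k D' (w \o h) (b \o h).
Proof.
move=> hI <- bP; have hD i : i \in D' -> h i \in h @: D' by apply: imset_f.
split=> [j /hD|j /hD|m|x s0 j jD] /=.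
- exact: (basis_hom bP).
- exact: (basis_vtx bP).
- by have [x ->] := basis_span bP m; exists (x \o h); rewrite big_imset.
pose y i := if [pick j in D' | h j == i] is Some j then x j else 0.
have yE i : i \in D' -> y (h i) = x i.
  rewrite /y => iD; case: pickP => [l /andP[lD /eqP e]|/(_ i)].
    by rewrite (hI _ _ lD iD e).
  by rewrite iD eqxx.
rewrite -yE //; apply: (basis_free bP) (hD _ jD).
by rewrite big_imset //= -[RHS]s0; apply: eq_bigr => i iD; rewrite yE.
Qed.

Lemma has_rank_ord (P : grModule L) k u : has_rank P k u ->
  exists (N : nat) (w : 'I_N -> V) (b : 'I_N -> P),
    basis k [set: 'I_N] w b /\ forall v, #|[set i | w i == v]| = u v.
Proof.
move=> [J [D [w [b [bP hu]]]]].
have eI : {in [set: 'I_#|D|] &, injective (@enum_val _ (mem D))}.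
  by move=> i j _ _; apply: enum_val_inj.
have eD : (@enum_val _ (mem D)) @: [set: 'I_#|D|] = D.
  apply/setP => j; apply/imsetP/idP => [[i _ ->]|jD]; first exact: enum_valP.
  by exists (enum_rank_in jD j); rewrite ?enum_rankK_in.
exists #|D|, (w \o enum_val), (b \o enum_val); split; first exact: basis_reindex bP.
move=> v; rewrite -hu /fibre_card -(card_imset _ (@enum_val_inj _ (mem D))).
congr #|pred_of_set _|; apply/setP => j; apply/imsetP/idP => [[i + ->]|].
  by rewrite !inE => ->; rewrite enum_valP.
rewrite inE => /andP[jD wj]; exists (enum_rank_in jD j); rewrite ?inE /=.
  by rewrite enum_rankK_in.
by rewrite enum_rankK_in.
Qed.

Lemma eq_fibres_perm N (w w' : 'I_N -> V) :
  (forall v, #|[set i | w i == v]| = #|[set i | w' i == v]|) ->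
  exists p : 'S_N, w =1 w' \o p.
Proof.
move=> h; have /tuple_permP[p e] : perm_eq [tuple w i | i < N] [tuple w' i | i < N].
  have cE (z : 'I_N -> V) v : count_mem v [tuple z i | i < N] = #|[set i | z i == v]|.
    by rewrite /= count_map cardsE cardE size_filter -enumT.
  by apply/allP => v _ /=; rewrite !cE h.
exists p => i; have /(congr1 (fun t => nth (w i) t i)) := e.
by rewrite -!tnth_nth !tnth_mktuple.
Qed.

(** A rank determines the family of vertices up to a permutation of the indices. *)
Lemma has_rank_iso (P Q : grModule L) k u :
  has_rank P k u -> has_rank Q k u -> gr_iso P Q.
Proof.
move=> /has_rank_ord[N [w [b [bP hw]]]] /has_rank_ord[N' [w' [b' [bQ hw']]]].
have cN n (z : 'I_n -> V) : (forall v, #|[set i | z i == v]| = u v) -> n = \sum_v u v.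
  move=> hz; rewrite -{1}(card_ord n) -sum1_card (partition_big z predT) //=.
  by apply: eq_bigr => v _; rewrite -hz sum1dep_card; apply: eq_card => i; rewrite !inE.
have eN : N' = N by rewrite (cN _ _ hw) (cN _ _ hw').
case: _ / eN w b bP hw => w b bP hw.
have [p wp] : exists p : 'S_N', w =1 w' \o p by apply: eq_fibres_perm => v; rewrite hw hw'.
apply: (basis_iso bP (b' := b' \o p)); rewrite (funext wp).
apply: (basis_reindex (D := [set: 'I_N'])) bQ; first by move=> i j _ _; apply: perm_inj.
by apply/setP => i; rewrite inE; apply/imsetP; exists ((p^-1)%g i); rewrite ?permKV.
Qed.

Lemma has_rank_transport (P Q : grModule L) k u :
  gr_iso P Q -> has_rank P k u -> has_rank Q k u.
Proof.
move=> [f [[g fK gK] fc]] [J [D [w [b [bP hu]]]]].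
exists J, D, w, (f \o b); split=> //; split=> [j jD|j jD|m|x s0] /=.
- exact/fc/(basis_hom bP).
- by rewrite -linear_ract (basis_vtx bP).
- have [x e] := basis_span bP (g m); exists x.
  by rewrite -[LHS]gK e linear_sum; apply: eq_bigr => j _; rewrite linear_ract.
- apply: (basis_free bP); apply: (can_inj fK); rewrite linear0 -[RHS]s0 linear_sum.
  by apply: eq_bigr => j _; rewrite linear_ract.
Qed.

Lemma has_rank_zero k : has_rank (gm_zero L) k (fun=> 0%N).
Proof.
exists void, finset.set0, (@of_void _), (fun=> 0).
split=> [|v]; last by apply: eq_card0 => -[].
split=> [[]|[]|m|x _ []] //.
by exists (fun=> 0); apply: rV0_eq.
Qed.

(** P(n)_k = P_(n + k), so the same family is a basis of the shift. *)
Lemma has_rank_shift (P : grModule L) n k u :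
  has_rank P (n + k) u -> has_rank (gm_shift P n) k u.
Proof.
move=> [J [D [w [b [bP hu]]]]]; exists J, D, w, b; split=> //.
by split; case: bP.
Qed.

Lemma has_rank_sum (P Q : grModule L) k u u' :
  has_rank P k u -> has_rank Q k u' ->
  has_rank (gm_sum P Q) k (fun v => u v + u' v)%N.
Proof.
move=> [J [D [w [b [bP hu]]]]] [J' [D' [w' [b' [bQ hu']]]]].
pose T : {set J + J'} := [set x | match x with inl j => j \in D | inr j => j \in D' end].
pose wT (x : J + J') := match x with inl j => w j | inr j => w' j end.
pose bT (x : J + J') : gm_sum P Q := match x with inl j => (b j, 0) | inr j => (0, b' j) end.
have pairE (s : P) (t : Q) x : ((s, t) : gm_sum P Q) |> x = (s |> x, t |> x) by [].
have pairD (s s' : P) (t t' : Q) : (s, t) + (s', t') = (s + s', t + t') by [].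
have sumE (x : J + J' -> L) : \sum_(i in T) bT i |> x i =
    (\sum_(j in D) b j |> x (inl j), \sum_(j in D') b' j |> x (inr j)) :> (P * Q)%type.
  rewrite big_sumType /=.
  under eq_bigl do rewrite inE; under [X in _ + X]eq_bigl do rewrite inE.
  have -> : \sum_(j in D) bT (inl j) |> x (inl j) =
      (\sum_(j in D) b j |> x (inl j), 0) :> (P * Q)%type.
    by elim/big_rec2: _ => // j y1 y2 _ ->; rewrite [bT _ |> _]pairE ract0l pairD addr0.
  have -> : \sum_(j in D') bT (inr j) |> x (inr j) =
      (0, \sum_(j in D') b' j |> x (inr j)) :> (P * Q)%type.
    by elim/big_rec2: _ => // j y1 y2 _ ->; rewrite [bT _ |> _]pairE ract0l pairD addr0.
  by rewrite pairD addr0 add0r.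
exists (J + J')%type, T, wT, bT; split; last first.
  move=> v; rewrite -hu -hu' /fibre_card -!sum1_card big_sumType /=.
  by congr (_ + _)%N; apply: eq_bigl => j; rewrite !inE.
split.
- move=> [j|j]; rewrite inE => jD; split=> /=; try exact: grading0 (gm_grading _) _.
    exact: (basis_hom bP).
  exact: (basis_hom bQ).
- move=> [j|j]; rewrite inE => jD; rewrite [LHS]pairE.
    by rewrite (basis_vtx bP) // ract0l.
  by rewrite (basis_vtx bQ) // ract0l.
- move=> [m m']; have [x ->] := basis_span bP m; have [x' ->] := basis_span bQ m'.
  by exists (fun i => match i with inl j => x j | inr j => x' j end); rewrite sumE.
- move=> x; rewrite sumE => -[sP sQ] [j|j]; rewrite inE => jD.
    exact: (basis_free bP (x := x \o inl)).
  exact: (basis_free bQ (x := x \o inr)).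
Qed.

Section Refinement.
Hypothesis no_sink : forall v : V, exists a : edge E, src a = v.

Definition refine (J : finType) (D : {set J}) (w : J -> V) : {set J * edge E} :=
  [set x | (x.1 \in D) && (src x.2 == w x.1)].

(** The transpose of the adjacency matrix, acting on functions of vertices. *)
Definition step (u : V -> nat) (v : V) : nat := \sum_(a | rng a == v) u (src a).

Lemma big_refine (M : nmodType) (J : finType) (D : {set J}) (w : J -> V)
    (F : J * edge E -> M) :
  \sum_(x in refine D w) F x = \sum_(j in D) \sum_(a | src a == w j) F (j, a).
Proof.
rewrite pair_big_dep /=; apply: eq_big => [[j a]|[]//]; by rewrite inE.
Qed.

Lemma fibre_card_refine (J : finType) (D : {set J}) (w : J -> V) :
  fibre_card (refine D w) (fun x => rng x.2) =1 step (fibre_card D w).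
Proof.
move=> v; rewrite /fibre_card /step -sum1_card.
pose inD a j := (j \in D) && (w j == src a).
have swapE (x : J * edge E) :
    (x \in [set x in refine D w | rng x.2 == v]) = (rng x.2 == v) && inD x.2 x.1.
  by rewrite !inE andbC [src _ == _]eq_sym.
rewrite (eq_bigl _ _ swapE).
rewrite (reindex_onto (fun y => (y.2, y.1)) (fun x => (x.2, x.1))) => [|[]//] /=.
under eq_bigl => y do rewrite -surjective_pairing eqxx andbT.
rewrite -(pair_big_dep (fun a => rng a == v) inD (fun _ _ => 1%N)) /=.
by apply: eq_bigr => a _; rewrite -sum1_card; apply: eq_bigl => j; rewrite inE.
Qed.

(** Spanning: b_j is the sum of the b_j a a^*.  Freeness: if the b_j a x_(j,a)
    sum to zero, then so does the sum over a of a x_(j,a) for each j, and a^*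
    isolates each term. *)
Lemma basis_refine (P : grModule L) k (J : finType) (D : {set J}) w (b : J -> P) :
  basis k D w b ->
  basis (k + 1) (refine D w) (fun x => rng x.2) (fun x => b x.1 |> edg x.2).
Proof.
move=> bP; split=> [[j a]|[j a]|m|x s0 [j a]] /=.
- rewrite inE => /andP[jD _]; apply: ract_deg; first exact: (basis_hom bP).
  exact: deg_edg.
- by move=> _; rewrite -ractM edg_rng.
- have [x ->] := basis_span bP m; exists (fun y => gho y.2 * x y.1).
  rewrite big_refine /=; apply: eq_bigr => j jD.
  rewrite -(basis_vtxl bP _ jD) -(sum_edg_gho _ no_sink) mulr_suml ract_sumr.
  by apply: eq_bigr => a _; rewrite -ractM mulrA.
- rewrite inE => /andP[jD /= /eqP sa].
  move: s0; rewrite big_refine /= => s0.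
  have s1 : \sum_(j in D) b j |> (\sum_(a | src a == w j) edg a * x (j, a)) = 0.
    rewrite -[RHS]s0; apply: eq_bigr => i _; rewrite ract_sumr.
    by apply: eq_bigr => c _; rewrite ractM.
  have /(congr1 (GRing.mul (gho a))) := basis_free bP s1 jD.
  rewrite mulr0 mulrA -sa gho_src mulr_sumr (bigD1 a) //= mulrA gho_edg eqxx.
  rewrite big1 ?addr0 // => c /andP[_ ca].
  by rewrite mulrA gho_edg eq_sym (negPf ca) mul0r.
Qed.

Lemma has_rank_step (P : grModule L) k u : has_rank P k u -> has_rank P (k + 1) (step u).
Proof.
move=> [J [D [w [b [bP hu]]]]].
exists (J * edge E)%type, (refine D w), (fun x => rng x.2), (fun x => b x.1 |> edg x.2).
split; first exact: basis_refine.
by move=> v; rewrite fibre_card_refine; apply: eq_bigr => a _; rewrite hu.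
Qed.
End Refinement.
End Bases.

(** * Uniqueness of the rank up to refinement *)

Section Invariance.
Variables (K : fieldType) (E : finDigraph).
Hypothesis no_sink : forall v : vertex E, exists a : edge E, src a = v.

Local Notation V := (vertex E).
Local Notation L := (leavitt_path_algebra K E).
Local Notation vtx := (@vtx K E).
Local Notation edg := (@edg K E).
Local Notation gho := (@gho K E).
Local Notation scl := (@scl K E).

Lemma vdiagonal_corner v w (x : L) : vdiagonal x -> exists c : K,
  vtx v * x * vtx w = if v == w then scl c * vtx v else 0.
Proof.
move=> [c ->]; exists (c v); rewrite mulr_sumr mulr_suml (bigD1 v) //=.
rewrite mulrA -scl_comm -!mulrA vtx_vtx; rewrite big1 ?addr0.
  case: eqP => _; first by rewrite vtxK.
  by rewrite !mulr0.
move=> u /negPf uv; rewrite mulrA -scl_comm -!mulrA (mulrA (vtx v) (vtx u)).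
by rewrite (vtx_vtx _ v) eq_sym uv mul0r mulr0.
Qed.

(** x is a matrix of elements x_jl of w_j L w'_l, that is, of a linear map between
    the sums of the w'_l L and of the w_j L. *)
Definition supported (J J' : finType) (D : {set J}) (D' : {set J'}) (w : J -> V) (w' : J' -> V)
    (x : J -> J' -> L) : Prop :=
  forall j l, j \in D -> l \in D' -> vtx (w j) * x j l * vtx (w' l) = x j l.

(** Diagonal entries in w_j L w'_l are scalar multiples of w_j, and vanish unless
    w_j = w'_l.  So the part of x and y over a vertex v is given by matrices over
    K whose product is the identity, which bounds the size of the identity. *)
Lemma fibre_card_le (J J' : finType) (D : {set J}) (D' : {set J'}) w w'
    (x : J -> J' -> L) (y : J' -> J -> L) :
  supported D D' w w' x -> supported D' D w' w y ->
  (forall j l, j \in D -> l \in D' -> vdiagonal (x j l)) ->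
  (forall j l, j \in D -> l \in D' -> vdiagonal (y l j)) ->
  (forall i j, i \in D -> j \in D ->
     \sum_(l in D') x i l * y l j = if i == j then vtx (w i) else 0) ->
  forall v, (fibre_card D w v <= fibre_card D' w' v)%N.
Proof.
move=> sx sy dx dy xy v.
have /choice[c hc] (p : J * J') : exists c, p.1 \in D -> p.2 \in D' ->
    x p.1 p.2 = if w p.1 == w' p.2 then scl c * vtx (w p.1) else 0.
  have [jD|_] := boolP (p.1 \in D); last by exists 0.
  have [lD|_] := boolP (p.2 \in D'); last by exists 0.
  have [c e] := vdiagonal_corner (w p.1) (w' p.2) (dx _ _ jD lD).
  by exists c => _ _; rewrite -sx.
have /choice[d hd] (p : J' * J) : exists c, p.1 \in D' -> p.2 \in D ->
    y p.1 p.2 = if w' p.1 == w p.2 then scl c * vtx (w' p.1) else 0.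
  have [jD|_] := boolP (p.1 \in D'); last by exists 0.
  have [lD|_] := boolP (p.2 \in D); last by exists 0.
  have [c' e] := vdiagonal_corner (w' p.1) (w p.2) (dy _ _ lD jD).
  by exists c' => _ _; rewrite -sy.
pose Dv := [set j in D | w j == v]; pose Dv' := [set l in D' | w' l == v].
pose A : 'M[K]_(#|Dv|, #|Dv'|) := \matrix_(i, l) c (enum_val i, enum_val l).
pose B : 'M[K]_(#|Dv'|, #|Dv|) := \matrix_(l, i) d (enum_val l, enum_val i).
apply: (@mulmx1_min _ _ _ A B); apply/matrixP => i i'; rewrite !mxE.
have := enum_valP i; have := enum_valP i'; rewrite !inE.
move=> /andP[iD' /eqP wi'] /andP[iD /eqP wi].
apply/eqP; rewrite -subr_eq0; apply/eqP; apply: (scl_vtx_eq0 no_sink (v := v)).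
have := xy _ _ iD iD'.
rewrite (bigID (fun l => w' l == v)) /= [X in _ + X]big1 ?addr0; last first.
  move=> l /andP[lD /negPf wl]; rewrite (hc (_, _)) //= wi eq_sym wl.
  by rewrite mul0r.
rewrite (eq_bigl [in Dv']) => [|l]; last by rewrite !inE.
rewrite big_enum_val /= => e.
have -> : scl (\sum_j A i j * B j i' - (i == i')%:R) =
    scl (\sum_j A i j * B j i') - scl (i == i')%:R.
  by apply/eqP; rewrite eq_sym subr_eq -sclD subrK.
rewrite mulrBl; apply/eqP; rewrite subr_eq0; apply/eqP.
transitivity (if enum_val i == enum_val i' then vtx (w (enum_val i)) else 0).
  rewrite -e (big_morph scl (@sclD K E) (@scl0 K E)) mulr_suml.
  apply: eq_bigr => l _; have := enum_valP l; rewrite inE => /andP[lD /eqP wl].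
  rewrite (hc (_, _)) //= (hd (_, _)) //= !mxE wi wl wi' eqxx sclM.
  by rewrite -!mulrA; congr (_ * _); rewrite mulrA -scl_comm -mulrA vtxK.
rewrite (inj_eq enum_val_inj) wi; case: ifP => _; first by rewrite scl1 mul1r.
by rewrite scl0 mul0r.
Qed.

(** Refining both families replaces x_jl by a^* x_jl b, and the sum of the b b^*
    over the edges b leaving w'_l restores the product of the matrices.  After h
    refinements the entries are diagonal. *)
Lemma fibre_card_iter_le h (J J' : finType) (D : {set J}) (D' : {set J'}) w w'
    (x : J -> J' -> L) (y : J' -> J -> L) :
  supported D D' w w' x -> supported D' D w' w y ->
  (forall j l, j \in D -> l \in D' -> compressed h h (x j l)) ->
  (forall j l, j \in D -> l \in D' -> compressed h h (y l j)) ->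
  (forall i j, i \in D -> j \in D ->
     \sum_(l in D') x i l * y l j = if i == j then vtx (w i) else 0) ->
  forall v, (iter h (@step E) (fibre_card D w) v <= iter h (@step E) (fibre_card D' w') v)%N.
Proof.
elim: h J J' D D' w w' x y => [|h IH] J J' D D' w w' x y sx sy cx cy xy.
  exact: fibre_card_le sx sy cx cy xy.
rewrite !iterSr -(funext (fibre_card_refine D w)) -(funext (fibre_card_refine D' w')).
apply: (IH _ _ _ _ _ _ (fun p q => gho p.2 * x p.1 q.1 * edg q.2)
                       (fun q p => gho q.2 * y q.1 p.1 * edg p.2)).
- by move=> [j a] [l b] _ _ /=; rewrite !mulrA rng_gho -!mulrA edg_rng.
- by move=> [l b] [j a] _ _ /=; rewrite !mulrA rng_gho -!mulrA edg_rng.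
- move=> [j a] [l b]; rewrite !inE => /andP[/= jD _] /andP[/= lD _].
  exact: (proj1 (compressedSr _ _ _) (cx _ _ jD lD a) b).
- move=> [j a] [l b]; rewrite !inE => /andP[/= jD _] /andP[/= lD _].
  exact: (proj1 (compressedSr _ _ _) (cy _ _ jD lD b) a).
- move=> [i a] [j b]; rewrite !inE => /andP[/= iD /eqP ai] /andP[/= jD /eqP bj].
  rewrite big_refine /=.
  have -> : \sum_(l in D') \sum_(c | src c == w' l)
      (gho a * x i l * edg c * (gho c * y l j * edg b)) =
      gho a * (\sum_(l in D') x i l * y l j) * edg b.
    rewrite mulr_sumr mulr_suml; apply: eq_bigr => l lD.
    have e : x i l = x i l * vtx (w' l) by rewrite -(sx i l iD lD) -[RHS]mulrA vtxK.
    rewrite [in RHS]e -(sum_edg_gho _ no_sink) mulr_sumr !mulr_suml mulr_sumr mulr_suml.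
    by apply: eq_bigr => c _; rewrite !mulrA.
  rewrite xy // xpair_eqE; case: eqP => [_|_] /=; last by rewrite mulr0 mul0r.
  by rewrite -ai gho_src gho_edg.
Qed.

Lemma has_rank_iter_step (P : grModule L) k u h : has_rank P k u ->
  has_rank P (k + h%:Z) (iter h (@step E) u).
Proof.
move=> hu; elim: h => [|h IH]; first by rewrite addr0.
by rewrite intS addrCA addrC /=; apply: has_rank_step.
Qed.

(** The change of basis matrices have entries of degree zero since both bases have
    the same degree. *)
Lemma has_rank_iter_le (P : grModule L) k u u' :
  has_rank P k u -> has_rank P k u' -> exists h, forall g, (h <= g)%N ->
    forall v, (iter g (@step E) u v <= iter g (@step E) u' v)%N.
Proof.
move=> [J [D [w [b [bP hu]]]]] [J' [D' [w' [b' [bP' hu']]]]].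
have trans (I I' : finType) (C : {set I}) (C' : {set I'}) z z' (c : I -> P) (c' : I' -> P) :
    basis k C z c -> basis k C' z' c' -> exists x : I -> I' -> L,
    [/\ supported C C' z z' x, forall i l, gr_comp 0 (x i l) &
       forall l, l \in C' -> c' l = \sum_(i in C) c i |> x i l].
  move=> bc bc'; have /choice[x hx] := fun l => basis_coord bc (c' l).
  (* Zero off the index sets, so that every entry has degree zero. *)
  exists (fun i l => if (i \in C) && (l \in C') then x l i * vtx (z' l) else 0).
  split.
  - by move=> i l -> -> /=; have [zx _] := hx l; rewrite mulrA zx -mulrA vtxK.
  - move=> i l; case: ifP => [/andP[iC lC]|_]; last exact: comp_zero.
    rewrite -[0]addr0; apply: gr_mul (deg_vtx _ _).
    have [zx e] := hx l; rewrite -(subrr k).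
    by apply: (basis_coord_deg bc _ zx iC); rewrite -e; apply: (basis_hom bc').
  - move=> l lC; rewrite -{1}(basis_vtx bc' lC); have [_ {1}->] := hx l.
    rewrite ract_suml; apply: eq_bigr => i iC.
    by rewrite iC lC /= ractM.
have [x [sx x0 xE]] := trans _ _ _ _ _ _ _ _ bP bP'.
have [y [sy y0 yE]] := trans _ _ _ _ _ _ _ _ bP' bP.
have [h1 hx] := compressed_deg0_family no_sink (fun p : J * J' => x0 p.1 p.2).
have [h2 hy] := compressed_deg0_family no_sink (fun p : J' * J => y0 p.1 p.2).
exists (h1 + h2)%N => g hg v; rewrite -(funext hu) -(funext hu').
apply: (fibre_card_iter_le sx sy) => [j l _ _|j l _ _|i j iD jD].
- by have := compressed_raise (g - h1) (hx (j, l)); rewrite subnKC //; lia.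
- by have := compressed_raise (g - h2) (hy (l, j)); rewrite subnKC //; lia.
have e : \sum_(i in D) b i |> (\sum_(l in D') x i l * y l j) =
    \sum_(i in D) b i |> (if i == j then vtx (w i) else 0).
  rewrite [RHS](bigD1 j) //= eqxx (basis_vtx bP jD) [X in _ + X]big1 ?addr0; last first.
    by move=> l /andP[_ /negPf ->]; rewrite ract0.
  rewrite (yE _ jD); under eq_bigr do rewrite ract_sumr.
  rewrite exchange_big /=; apply: eq_bigr => l lD.
  by rewrite (xE _ lD) ract_suml; apply: eq_bigr => i' _; rewrite ractM.
have := basis_eq bP e iD; rewrite mulr_sumr.
under eq_bigr => l lD do rewrite -(sx i l iD lD) !mulrA vtxK.
under eq_bigr => l lD do rewrite (sx i l iD lD).
by move=> ->; case: ifP; rewrite ?vtxK ?mulr0.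
Qed.

Lemma has_rank_unique (P : grModule L) k u u' :
  has_rank P k u -> has_rank P k u' -> exists h,
    iter h (@step E) u =1 iter h (@step E) u'.
Proof.
move=> hu hu'; have [h hh] := has_rank_iter_le hu hu'.
have [h' hh'] := has_rank_iter_le hu' hu; exists (h + h')%N => v.
by apply/eqP; rewrite eqn_leq hh ?hh' //; lia.
Qed.
End Invariance.

(** * Graded projective modules have bases *)

Section Existence.
Variables (K : fieldType) (E : finDigraph).
Hypothesis no_sink : forall v : vertex E, exists a : edge E, src a = v.

Local Notation V := (vertex E).
Local Notation L := (leavitt_path_algebra K E).
Local Notation vtx := (@vtx K E).
Local Notation edg := (@edg K E).
Local Notation gho := (@gho K E).
Local Notation scl := (@scl K E).

Section Generators.
Variable P : grModule L.

Definition generated_at (k : int) (s : seq P) : Prop :=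
  exists (J : finType) (g : J -> P), (forall j, gm_comp k (g j)) /\
    forall m, m \in s -> exists x : J -> L, m = \sum_j g j |> x j.

Definition eventually_generated (s : seq P) : Prop :=
  exists k0 : nat, forall k : nat, (k0 <= k)%N -> generated_at k%:Z s.

(** m is the sum of the m a a^*, and m a has one degree more. *)
Lemma generated_hom d h (m : P) : gm_comp d m -> generated_at (d + h%:Z) [:: m].
Proof.
move=> md; elim: h => [|h [J [g [gh gs]]]].
  exists unit, (fun=> m); rewrite addr0; split=> // n; rewrite inE => /eqP ->.
  by exists (fun=> 1); rewrite big_const card_unit /= addr0 ract1.
exists (J * edge E)%type, (fun x => g x.1 |> edg x.2); split.
  by move=> [j a]; rewrite intS addrCA addrC; apply: ract_deg (gh j) (deg_edg _ _).
move=> n nm; have [x ->] := gs n nm; exists (fun p => gho p.2 * x p.1).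
rewrite -(pair_bigA _ (fun j a => g j |> edg a |> (gho a * x j))) /=.
apply: eq_bigr => j _; rewrite -{1}[x j]mul1r -(sum_edges _ no_sink) mulr_suml ract_sumr.
by apply: eq_bigr => a _; rewrite -ractM mulrA.
Qed.

Lemma eventually_hom d (m : P) : gm_comp d m -> eventually_generated [:: m].
Proof.
move=> md; exists `|d|%N => k dk; have -> : k%:Z = d + (`|k%:Z - d|%N)%:Z by lia.
exact: generated_hom.
Qed.

Lemma eventually_cat s t : eventually_generated s -> eventually_generated t ->
  eventually_generated (s ++ t).
Proof.
move=> [k1 h1] [k2 h2]; exists (k1 + k2)%N => k hk.
have [J [g [gh gs]]] : generated_at k%:Z s by apply: h1; lia.
have [J' [g' [gh' gs']]] : generated_at k%:Z t by apply: h2; lia.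
exists (J + J')%type, (fun i => match i with inl j => g j | inr j => g' j end).
split=> [[j|j] //|m]; rewrite mem_cat => /orP[/gs|/gs'] [x ->].
  exists (fun i => match i with inl j => x j | inr j => 0 end).
  by rewrite big_sumType /= [X in _ + X]big1 ?addr0 // => j _; apply: ract0.
exists (fun i => match i with inl j => 0 | inr j => x j end).
by rewrite big_sumType /= [X in X + _]big1 ?add0r // => j _; apply: ract0.
Qed.

Lemma eventually_seq (s : seq P) :
  (forall m, m \in s -> eventually_generated [:: m]) -> eventually_generated s.
Proof.
elim: s => [|m s IH] h.
  by exists 0%N => k _; exists void, (fun=> 0); split=> [[]|].
apply: (@eventually_cat [:: m]); first exact/h/mem_head.
by apply: IH => n ns; apply: h; rewrite inE ns orbT.
Qed.

Lemma eventually_all (s : seq P) : eventually_generated s.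
Proof.
apply: eventually_seq => m _; have [t [ht ->]] := grading_span (gm_grading P) m.
have [|k0 h] := @eventually_seq t; first by move=> n /ht[d nd]; apply: eventually_hom nd.
exists k0 => k /h[J [g [gh gs]]]; exists J, g; split=> // n; rewrite inE => /eqP -> {n}.
have : {subset t <= t} by [].
elim: {1 3}t => [|n r IH] rt.
  by exists (fun=> 0); rewrite big_nil big1 // => j _; apply: ract0.
have [x e] := gs n (rt n (mem_head _ _)).
have [|y e'] := IH; first by move=> l lr; apply: rt; rewrite inE lr orbT.
exists (fun j => x j + y j); rewrite big_cons e e' -big_split; apply: eq_bigr => j _.
by rewrite ractDr.
Qed.

Lemma fg_homogeneous : finitely_generated P ->
  exists (k : nat) (J : finType) (g : J -> P), (forall j, gm_comp k%:Z (g j)) /\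
    forall m, exists x : J -> L, m = \sum_j g j |> x j.
Proof.
move=> [s hs]; have [k0 h] := eventually_all s.
have [J [g [gh gs]]] := h k0 (leqnn _); exists k0, J, g; split=> // m.
have [a ->] := hs m.
have /choice[x hx] (i : 'I_(size s)) : exists x : J -> L, s`_i = \sum_j g j |> x j.
  by apply/gs/mem_nth.
exists (fun j => \sum_i x i j * (a i : L)).
transitivity (\sum_(i < size s) s`_i |> (a i : L)); first by [].
under eq_bigr => i _ do rewrite hx ract_suml.
rewrite exchange_big; apply: eq_bigr => j _; rewrite ract_sumr.
by apply: eq_bigr => i _; rewrite ractM.
Qed.
End Generators.

(** e is the matrix, on the generators g_j, of a projection of the free module on
    them whose kernel is the module of relations: pres_fix says that e is the
    identity modulo relations, pres_rel that it kills them. *)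
Record presentation (P : grModule L) (k : int) (J : finType) (g : J -> P)
    (e : J -> J -> L) : Prop := Presentation {
  pres_hom : forall j, gm_comp k (g j);
  pres_span : forall m, exists x : J -> L, m = \sum_j g j |> x j;
  pres_deg : forall i j, gr_comp 0 (e i j);
  pres_fix : forall j, \sum_i g i |> e i j = g j;
  pres_rel : forall x : J -> L, \sum_j g j |> x j = 0 ->
    forall i, \sum_j e i j * x j = 0
}.

(** A section s of the map from the free module onto P gives the matrix s_i(g_j).
    The section need not respect degrees, but as the generators all have degree k,
    the degree zero components of its entries satisfy the same relations. *)
Lemma projective_presentation (P : grProj L) :
  exists (k : nat) (J : finType) (g : J -> P) e, presentation k%:Z g e.
Proof.
have [k [J [g [gh gs]]]] := fg_homogeneous (gp_fg P).
pose N : lmodType L^c := {ffun J -> (L^c)^o}.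
pose p0 (x : N) : P := \sum_j g j |> (x j : L).
have [p pE] : exists p : {linear N -> P}, p =1 p0.
  apply: linear_of_ract => [x y|x c]; rewrite /p0.
    by rewrite -big_split; apply: eq_bigr => j _; rewrite ffunE ractDr.
  by rewrite ract_suml; apply: eq_bigr => j _; rewrite -ractM ffunE.
have [|h hK] := @gp_proj _ P N P p idfun.
  move=> m; have [x ->] := gs m; exists [ffun j => x j : (L^c)^o].
  by rewrite pE; apply: eq_bigr => j _; rewrite ffunE.
pose s i (m : P) : L := (h m : N) i.
have sE m : m = \sum_i g i |> s i m by rewrite -[LHS]/(idfun m) -(hK m) pE.
have s0 i : s i 0 = 0 by rewrite /s linear0 ffunE.
have sD i : {morph s i : m n / m + n} by move=> m n; rewrite /s linearD ffunE.
have sZ i m x : s i (m |> x) = s i m * x by rewrite /s linear_ract ffunE.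
exists k, J, g, (fun i j => rcomp 0 (s i (g j))); split=> //.
- by move=> i j; apply: rcompP.
- move=> j; rewrite -[RHS](mcomp_id (gh j)) [in RHS](sE (g j)) mcomp_sum.
  by apply: eq_bigr => i _; rewrite -[k%:Z]add0r mcomp_ractl.
- move=> x x0 i; apply: rcomp_eq0 => d; rewrite rcomp_sum.
  have : \sum_j g j |> rcomp d (x j) = 0.
    have := congr1 (mcomp (d + k%:Z)) x0.
    rewrite mcomp_sum [RHS](_ : _ = 0); last exact: hcomp0.
    by move=> e; rewrite -[RHS]e; apply: eq_bigr => j _; rewrite mcomp_ractl.
  move=> /(congr1 (s i)); rewrite s0 (big_morph _ (sD i) (s0 i)).
  move=> /(congr1 (rcomp d)); rewrite rcomp0 rcomp_sum => e; rewrite -[RHS]e.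
  apply: eq_bigr => j _; rewrite sZ; transitivity (rcomp 0 (s i (g j)) * rcomp d (x j)).
    by rewrite -{1}[d]addr0 rcomp_mull //; apply: rcompP.
  by rewrite -{2}[d]add0r rcomp_mulr //; apply: rcompP.
Qed.

(** Any factorization of the unit as the sum of the p_t q_t refines a
    presentation: with edges and ghost edges it raises the degree by one, with
    p_t = q_t ranging over the vertices it splits generators along the vertices. *)
Lemma presentation_refine (P : grModule L) k (J T : finType) (g : J -> P) e r
    (p q : T -> L) :
  (forall t, gr_comp r (p t)) -> (forall t, gr_comp (- r) (q t)) ->
  \sum_t p t * q t = 1 -> presentation k g e ->
  presentation (k + r) (fun y : J * T => g y.1 |> p y.2)
    (fun y z => q y.2 * e y.1 z.1 * p z.2).
Proof.
move=> pr qr pq1 [gh gs ed efix erel]; split.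
- by move=> [j t]; apply: ract_deg.
- move=> m; have [x ->] := gs m; exists (fun y => q y.2 * x y.1).
  rewrite -(pair_bigA _ (fun j t => g j |> p t |> (q t * x j))) /=.
  apply: eq_bigr => j _; rewrite -{1}[x j]mul1r -pq1 mulr_suml ract_sumr.
  by apply: eq_bigr => t _; rewrite -ractM mulrA.
- move=> [i t] [j t'] /=.
  by have := gr_mul (gr_mul (qr t) (ed i j)) (pr t'); rewrite addr0 addNr.
- move=> [j t] /=.
  rewrite -(pair_bigA _ (fun i t' => g i |> p t' |> (q t' * e i j * p t))) /=.
  rewrite -efix ract_suml; apply: eq_bigr => i _.
  rewrite -[in RHS](mul1r (e i j)) -pq1 mulr_suml ract_sumr ract_suml.
  by apply: eq_bigr => t' _; rewrite -!ractM !mulrA.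
- move=> x x0 [i t] /=.
  rewrite (eq_bigr (fun y => q t * e i y.1 * p y.2 * x (y.1, y.2))) => [|[]//].
  rewrite -(pair_bigA _ (fun j t' => q t * e i j * p t' * x (j, t'))) /=.
  have h : \sum_j g j |> (\sum_t' p t' * x (j, t')) = 0.
    rewrite -[RHS]x0 [RHS](eq_bigr (fun y => g y.1 |> p y.2 |> x (y.1, y.2))) => [|[]//].
    rewrite -(pair_bigA _ (fun j t' => g j |> p t' |> x (j, t'))) /=.
    apply: eq_bigr => j _; rewrite ract_sumr; apply: eq_bigr => t' _.
    by rewrite ractM.
  transitivity (q t * \sum_j e i j * (\sum_t' p t' * x (j, t'))); last first.
    by rewrite (erel _ h i) mulr0.
  rewrite mulr_sumr; apply: eq_bigr => j _.
  by rewrite !mulr_sumr; apply: eq_bigr => t' _; rewrite !mulrA.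
Qed.

Lemma presentation_diagonal (P : grModule L) h k (J : finType) (g : J -> P) e :
  presentation k g e -> (forall i j, compressed h h (e i j)) ->
  exists (J' : finType) (g' : J' -> P) e',
    presentation (k + h%:Z) g' e' /\ forall i j, vdiagonal (e' i j).
Proof.
elim: h k J g e => [|h IH] k J g e pe ce; first by exists J, g, e; rewrite addr0.
have pe' := presentation_refine (@deg_edg K E) (@deg_gho K E) (sum_edges K no_sink) pe.
have [|J' [g' [e' [pe'' de']]]] := IH _ _ _ _ pe'.
  by move=> [i a] [j b]; apply: (proj1 (compressedSr _ _ _) (ce i j a)).
by exists J', g', e'; split=> //; rewrite intS addrA.
Qed.

(** A presentation whose matrix has entries in K.  The factors vtx (w j) appear in
    spres_rel because g_j only sees w_j x_j. *)
Record scalar_presentation (P : grModule L) (k : int) (J : finType) (D : {set J})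
    (w : J -> V) (g : J -> P) (c : J -> J -> K) : Prop := ScalarPresentation {
  spres_hom : forall j, j \in D -> gm_comp k (g j);
  spres_vtx : forall j, j \in D -> g j |> vtx (w j) = g j;
  spres_span : forall m, exists x : J -> L, m = \sum_(j in D) g j |> x j;
  spres_fix : forall j, j \in D -> \sum_(i in D) g i |> scl (c i j) = g j;
  spres_rel : forall x : J -> L, \sum_(j in D) g j |> x j = 0 ->
    forall i, i \in D -> \sum_(j in D) scl (c i j) * (vtx (w j) * x j) = 0
}.

Lemma scalar_presentation_ex (P : grProj L) :
  exists (k : nat) (J : finType) (w : J -> V) (g : J -> P) c,
    scalar_presentation k%:Z [set: J] w g c.
Proof.
have [k0 [J0 [g0 [e0 pe0]]]] := projective_presentation P.
have [h ce0] := compressed_deg0_family no_sink (fun p : J0 * J0 => pres_deg pe0 p.1 p.2).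
have [J1 [g1 [e1 [pe1 de1]]]] := presentation_diagonal pe0 (fun i j => ce0 (i, j)).
(* Splitting along the vertices turns the diagonal entries into scalars. *)
have deg0N v : gr_comp (- 0) (vtx v) by rewrite oppr0; apply: deg_vtx.
have sv : \sum_v vtx v * vtx v = 1.
  by rewrite sum_vtx; apply: eq_bigr => v _; rewrite vtxK.
have := presentation_refine (@deg_vtx K E) deg0N sv pe1.
have /choice[c hc] (p : J1 * J1) : exists c : V -> K,
    e1 p.1 p.2 = \sum_v scl (c v) * vtx v by apply: de1.
pose C (y z : J1 * V) : K := if y.2 == z.2 then c (y.1, z.1) z.2 else 0.
have eC (y z : J1 * V) : vtx y.2 * e1 y.1 z.1 * vtx z.2 = scl (C y z) * vtx z.2.
  rewrite (hc (_, _)) mulr_sumr mulr_suml (bigD1 z.2) //= big1 ?addr0 => [|v /negPf vz].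
    rewrite mulrA -scl_comm -!mulrA vtxK vtx_vtx /C; case: eqP => [->//|_].
    by rewrite mulr0 scl0 mul0r.
  by rewrite -!mulrA vtx_vtx vz !mulr0.
rewrite addr0 => -[gh gs _ gfix grel].
exists (k0 + h)%N, (J1 * V)%type, snd, (fun y => g1 y.1 |> vtx y.2), C.
split=> [j _|j _|m|j _|x x0 i _].
- exact: gh.
- by rewrite -ractM vtxK.
- by have [x ->] := gs m; exists x; apply: eq_bigl => j; rewrite inE.
- rewrite -[RHS]gfix; apply: eq_big => [i|i _]; first by rewrite inE.
  rewrite eC /C; case: eqP => [<-|_]; last by rewrite scl0 mul0r.
  by rewrite scl_comm ractM -[_ |> vtx _ |> vtx _]ractM vtxK.
- have x1 : \sum_y g1 y.1 |> vtx y.2 |> x y = 0.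
    by rewrite -[RHS]x0; apply: eq_bigl => y; rewrite inE.
  rewrite -[RHS](grel _ x1 i); apply: eq_big => [y|y _]; first by rewrite inE.
  by rewrite eC mulrA.
Qed.

(** If the matrix is the identity, spres_rel is freeness.  Otherwise spres_fix
    provides a nontrivial linear relation with coefficients eta in K among the
    generators; solving it for a generator g_i0 with eta i0 != 0 expresses g_i0 by
    the others, with coefficients mu, and adding mu times row i0 to the other rows
    yields a matrix for the remaining generators. *)
Lemma scalar_presentation_basis (P : grModule L) k (J : finType) (D : {set J})
    w (g : J -> P) c :
  scalar_presentation k D w g c -> exists D' : {set J}, basis k D' w g.
Proof.
have [n] := ubnP #|D|; elim: n => // n IH in D c * => Dn pc.
have [allP|] := boolP [forall i in D, forall j in D, c i j == (i == j)%:R].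
  have {}allP i j : i \in D -> j \in D -> c i j = (i == j)%:R.
    by move=> iD jD; apply/eqP; have /forall_inP/(_ i iD)/forall_inP := allP; apply.
  exists D; case: pc => [gh gv gs gfix grel]; split=> // x x0 i iD.
  have := grel x x0 i iD; rewrite (bigD1 i) //= allP // eqxx scl1 mul1r big1 ?addr0 //.
  by move=> j /andP[jD /negPf ji]; rewrite allP // eq_sym ji scl0 mul0r.
rewrite negb_forall_in => /existsP[i0 /andP[i0D]].
rewrite negb_forall_in => /existsP[j0 /andP[j0D c0]].
case: pc => [gh gv gs gfix grel].
pose eta i := c i j0 - (i == j0)%:R; have eta0 : eta i0 != 0 by rewrite subr_eq0.
have etaR : \sum_(i in D) g i |> scl (eta i) = 0.
  have : \sum_(i in D) g i |> scl (c i j0) - \sum_(i in D) g i |> scl (i == j0)%:R = 0.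
    rewrite gfix // [X in _ - X](bigD1 j0) //= eqxx scl1 ract1 big1 ?addr0 ?subrr //.
    by move=> i /andP[_ /negPf ->]; rewrite scl0 ract0.
  rewrite -sumrB => e; rewrite -[RHS]e; apply: eq_bigr => i _; rewrite -ractBr.
  congr (_ |> _); apply/eqP; rewrite eq_sym subr_eq -sclD.
  by rewrite /eta subrK.
pose mu i := - (eta i / eta i0).
have gi0 : g i0 = \sum_(i in D :\ i0) g i |> scl (mu i).
  have := congr1 (fun m : P => m |> scl (eta i0)^-1) etaR.
  rewrite ract0l (big_setD1 i0) //= ractDl -ractM -sclM mulfV // scl1 ract1.
  move=> /eqP; rewrite addr_eq0 => /eqP ->; rewrite ract_suml -sumrN.
  apply: eq_bigr => i _; rewrite -ractM -sclM -[LHS]sub0r -(ract0 (g i)) -ractBr.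
  by congr (_ |> _); apply/eqP; rewrite subr_eq -sclD /mu addNr scl0.
apply: (IH (D :\ i0) (fun l j => c l j + mu l * c i0 j)).
  by move: Dn; rewrite (cardsD1 i0 D) i0D.
have sub j : j \in D :\ i0 -> j \in D by rewrite in_setD1 => /andP[].
split=> [j /sub/gh//|j /sub/gv//|m|j /sub jD|x x0 l lD].
- have [x ->] := gs m; exists (fun j => x j + scl (mu j) * x i0).
  rewrite (big_setD1 i0) //= {1}gi0 ract_suml -big_split.
  by apply: eq_bigr => j _; rewrite /= ractDr ractM addrC.
- rewrite -[RHS]gfix // [RHS](big_setD1 i0) //= {1}gi0 ract_suml -big_split.
  by apply: eq_bigr => i _; rewrite /= sclD sclM ractDr ractM addrC.
- (* Relations among the remaining generators are relations among all of them. *)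
  pose y j := if j == i0 then 0 else x j.
  have yE (M : zmodType) (F : J -> L -> M) : (forall j, F j 0 = 0) ->
      \sum_(j in D) F j (y j) = \sum_(j in D :\ i0) F j (x j).
    move=> F0; rewrite (big_setD1 i0) //= /y eqxx F0 add0r.
    by apply: eq_bigr => j; rewrite in_setD1 => /andP[/negPf ->].
  have y0 : \sum_(j in D) g j |> y j = 0.
    by rewrite (yE _ (fun j => ract (g j))) // => j; apply: ract0.
  have rel i : i \in D -> \sum_(j in D :\ i0) scl (c i j) * (vtx (w j) * x j) = 0.
    move=> iD; rewrite -[RHS](grel y y0 i iD).
    by rewrite (yE _ (fun j z => scl (c i j) * (vtx (w j) * z))) // => j; rewrite !mulr0.
  under eq_bigr => j _ do rewrite sclD sclM mulrDl -[scl (mu l) * _ * _]mulrA.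
  by rewrite big_split /= -mulr_sumr !rel ?mulr0 ?addr0 //; apply: sub.
Qed.

Lemma has_rank_ex (P : grProj L) : exists (k : nat) u, has_rank P k%:Z u.
Proof.
have [k [J [w [g [c /scalar_presentation_basis[D bD]]]]]] := scalar_presentation_ex P.
by exists k, (fibre_card D w), J, D, w, g.
Qed.
End Existence.

(** * Realization of every rank *)

Section Corner.
Variables (K : fieldType) (E : finDigraph) (v : vertex E).

Local Notation L := (leavitt_path_algebra K E).
Local Notation vtx := (@vtx K E).

(** The right ideal vL. *)
Definition in_corner : {pred (L^c)^o} := fun x => vtx v * (x : L) == x.

Fact in_corner_submod : submod_closed in_corner.
Proof.
split=> [|a x y]; rewrite !unfold_in; first by rewrite mulr0.
move=> /eqP ex /eqP ey; rewrite mulrDr ey; apply/eqP; congr (_ + _).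
by rewrite -[RHS]/((x : L) * (a : L)) -{2}ex mulrA.
Qed.

HB.instance Definition _ := GRing.isSubmodClosed.Build L^c (L^c)^o in_corner in_corner_submod.

Definition corner : Type := {x : (L^c)^o | in_corner x}.

HB.instance Definition _ := SubType.on corner.
HB.instance Definition _ := [Choice of corner by <:].
HB.instance Definition _ := [SubChoice_isSubLmodule of corner by <:].

(** The converse ring carries the product in the other order, so elements are
    read in L itself. *)
Definition cval (x : corner) : L := val x.

Lemma cval_inj : injective cval. Proof. exact: val_inj. Qed.
Lemma cval0 : cval 0 = 0. Proof. exact: (raddf0 (val : corner -> (L^c)^o)). Qed.
Lemma cvalD x y : cval (x + y) = cval x + cval y.
Proof. exact: (raddfD (val : corner -> (L^c)^o)). Qed.
Lemma cvalB x y : cval (x - y) = cval x - cval y.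
Proof. exact: (raddfB (val : corner -> (L^c)^o)). Qed.
Lemma cval_sum I (r : seq I) (P : pred I) (F : I -> corner) :
  cval (\sum_(i <- r | P i) F i) = \sum_(i <- r | P i) cval (F i).
Proof. exact: (big_morph cval cvalD cval0). Qed.
Lemma cval_act (x : corner) (y : L) : cval (x |> y) = cval x * y.
Proof. by rewrite /cval /ract linearZ. Qed.

Lemma cvalP x : vtx v * cval x = cval x.
Proof. exact/eqP/(valP x). Qed.

Lemma corner_of (x : L) : exists y : corner, cval y = vtx v * x.
Proof.
have h : in_corner (vtx v * x : L) by rewrite /in_corner mulrA vtxK.
by exists (Sub (vtx v * x : L) h); rewrite /cval SubK.
Qed.

Definition corner_comp (k : int) : set corner := fun x => gr_comp k (cval x).

Lemma corner_grading : is_grading corner_comp.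
Proof.
have [c0 cB cS cI] := gr_grading L; split.
- by move=> k; rewrite /corner_comp cval0.
- by move=> k x y cx cy; rewrite /corner_comp cvalB; apply: cB.
- move=> x; have [s [hs e]] := cS (cval x).
  have /choice[f hf] := corner_of.
  exists [seq f y | y <- s]; split.
    move=> _ /mapP[y ys ->]; have [k ck] := hs y ys; exists k.
    by rewrite /corner_comp hf -[k]add0r; apply: gr_mul (deg_vtx _ _) ck.
  apply: cval_inj; rewrite cval_sum big_map -[LHS]cvalP e mulr_sumr.
  by apply: eq_bigr => y _; rewrite hf.
- move=> S f uS hf s0 k kS; apply: cval_inj; rewrite cval0.
  apply: (cI S (cval \o f) uS hf _ k kS).
  by rewrite -[RHS]cval0 -s0 cval_sum.
Qed.

Lemma corner_act i j (m : corner) (b : L) : corner_comp i m -> gr_comp j b ->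
  corner_comp (i + j) (m |> b).
Proof. by move=> mi bj; rewrite /corner_comp cval_act; apply: gr_mul. Qed.

Definition corner_module : grModule L := GrModule corner_grading corner_act.

Definition corner_gen : corner_module := projT1 (cid (corner_of 1)).

Lemma corner_genE : cval corner_gen = vtx v.
Proof. by rewrite /corner_gen; case: cid => y /= ->; rewrite mulr1. Qed.

Lemma corner_gen_act (m : corner_module) : corner_gen |> cval m = m.
Proof. by apply: cval_inj; rewrite cval_act corner_genE cvalP. Qed.

Lemma corner_fg : finitely_generated corner_module.
Proof.
exists [:: corner_gen] => m; exists (fun=> cval m).
by rewrite big_ord1 /= -[LHS]corner_gen_act.
Qed.

(** A linear map on vL is the same as an element y with y v = y; the lift of f
    sends m to y m for any preimage y of f(v). *)
Lemma corner_projective : projective corner_module.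
Proof.
move=> N N' g f gs; have [y gy] := gs (f corner_gen).
have [h hE] : exists h : {linear corner_module -> N}, h =1 (fun m => y |> cval m).
  apply: linear_of_ract => [m n|m x]; first by rewrite cvalD ractDr.
  by rewrite cval_act ractM.
by exists h => m; rewrite hE linear_ract gy -linear_ract corner_gen_act.
Qed.

Definition corner_proj : grProj L := GrProj corner_fg corner_projective.

Lemma corner_rank : has_rank corner_proj 0 (fun w => (v == w)%N).
Proof.
exists unit, [set: unit], (fun=> v), (fun=> corner_gen); split; last first.
  move=> w; rewrite /fibre_card; case: eqP => _.
    by apply/eqP/cards1P; exists tt; apply/setP => -[]; rewrite !inE.
  by apply/eqP; rewrite cards_eq0; apply/eqP/setP => -[]; rewrite !inE.
have sum1 (F : unit -> corner_module) : \sum_(j in [set: unit]) F j = F tt.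
    by rewrite (bigD1 tt) ?inE //= big1 ?addr0 // => -[] /andP[].
split=> [j _|j _|m|x].
- by rewrite /gm_comp /= /corner_comp corner_genE; apply: deg_vtx.
- by apply: cval_inj; rewrite cval_act corner_genE vtxK.
- by exists (fun=> cval m); rewrite sum1 corner_gen_act.
rewrite sum1 => /(congr1 cval).
by rewrite cval_act corner_genE cval0 => e [] _.
Qed.
End Corner.

Section Realization.
Variables (K : fieldType) (E : finDigraph).
Local Notation L := (leavitt_path_algebra K E).

Lemma has_rank_realize (k : int) (u : vertex E -> nat) :
  exists P : grProj L, has_rank P k u.
Proof.
suff [P hP] : exists P : grProj L, has_rank P 0 u.
  by exists (gp_shift (- k) P); apply: has_rank_shift; rewrite addNr.
have sum0 u1 u2 : (exists P : grProj L, has_rank P 0 u1) ->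
    (exists P : grProj L, has_rank P 0 u2) ->
    exists P : grProj L, has_rank P 0 (fun v => u1 v + u2 v)%N.
  by move=> [P hP] [Q hQ]; exists (gp_sum P Q); apply: has_rank_sum.
have zero0 : exists P : grProj L, has_rank P 0 (fun=> 0%N).
  by exists (gp_zero L); apply: has_rank_zero.
(* The rank u is a sum of indicator functions, the ranks of the modules wL. *)
have -> : u = (fun v => \sum_w \sum_(i < u w) (w == v))%N.
  apply: funext => v; rewrite (bigD1 v) //= eqxx sum_nat_const card_ord muln1.
  rewrite big1 ?addn0 // => w /negPf ->.
  by rewrite sum_nat_const muln0.
have big_rank (I : Type) (r : seq I) (F : I -> vertex E -> nat) :
    (forall i, exists P : grProj L, has_rank P 0 (F i)) ->
    exists P : grProj L, has_rank P 0 (fun v => \sum_(i <- r) F i v)%N.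
  move=> hF; elim: r => [|i r IH].
    by rewrite (_ : (fun v => _) = fun=> 0%N) //; apply: funext => v; rewrite big_nil.
  rewrite (_ : (fun v => _) = fun v => (F i v + \sum_(j <- r) F j v)%N).
    exact: sum0.
  by apply: funext => v; rewrite big_cons.
apply: (big_rank _ _ (fun w v => \sum_(i < u w) (w == v))%N) => w.
apply: (big_rank _ _ (fun _ v => (w == v) : nat)) => _.
by exists (corner_proj K w); apply: corner_rank.
Qed.
End Realization.

(** * The isomorphism with the dimension group *)

Section DimensionClass.
Variables (K : fieldType) (E : finDigraph) (n : nat) (o : 'I_n -> vertex E).
Hypothesis o_bij : bijective o.
Hypothesis no_sink : forall v : vertex E, exists a : edge E, src a = v.

Local Notation V := (vertex E).
Local Notation L := (leavitt_path_algebra K E).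
Local Notation At := ((adjacency o)^T : 'M[nat]_n).

Definition rank_vec (u : V -> nat) : 'cV[int]_n := \col_i (u (o i))%:Z.

Lemma rank_vecD u u' : rank_vec (fun v => u v + u' v)%N = rank_vec u + rank_vec u'.
Proof. by apply/matrixP => i j; rewrite !mxE PoszD. Qed.

Lemma rank_vec_inj u u' : rank_vec u = rank_vec u' -> u = u'.
Proof.
have [o' _ oK] := o_bij; move=> e; apply: funext => v.
by have := congr1 (fun M : 'cV_n => M (o' v) 0) e; rewrite !mxE oK => -[].
Qed.

Lemma rank_vec_step u : map_mx Posz At *m rank_vec u = rank_vec (step u).
Proof.
apply/matrixP => i j; rewrite !mxE /step (partition_big (@src E) predT) //=.
rewrite (reindex o) /=; last exact: onW_bij.
rewrite (big_morph Posz PoszD (erefl 0)); apply: eq_bigr => l _; rewrite !mxE.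
rewrite (eq_bigr (fun=> u (o l))) => [|a /andP[_ /eqP ->]//].
rewrite sum_nat_const PoszM; congr (Posz _ * _); apply: eq_card => a.
by rewrite !inE andbC.
Qed.

Lemma rank_vec_iter k u : map_mx Posz At ^+ k *m rank_vec u = rank_vec (iter k (@step E) u).
Proof.
elim: k u => [|k IH] u; first by rewrite expr0 mul1mx.
by rewrite exprSr -mulmxA rank_vec_step IH -iterSr.
Qed.

Definition dim_class (k : nat) (u : V -> nat) : dim_group At := dim_cls At k (rank_vec u).

Lemma dim_class_iter m k u : dim_class (k + m) (iter m (@step E) u) = dim_class k u.
Proof.
by apply/dim_eqP; exists 0%N, m; rewrite /= addn0 expr0 mul1mx rank_vec_iter.
Qed.

Lemma dim_class_eq k u k' u' : dim_class k u = dim_class k' u' -> exists m m' : nat,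
  (k + m = k' + m')%N /\ iter m (@step E) u = iter m' (@step E) u'.
Proof.
move=> /dim_eqP[m [m' [/= e1 e2]]]; exists m, m'; split=> //.
by apply: rank_vec_inj; rewrite -!rank_vec_iter.
Qed.

Lemma has_rank_iter_nat (P : grModule L) (k m : nat) u : has_rank P k%:Z u ->
  has_rank P (k + m)%N%:Z (iter m (@step E) u).
Proof. by rewrite PoszD; apply: has_rank_iter_step. Qed.

(** Both bases are refined to the common degree k + k'. *)
Lemma has_rank_class (P : grModule L) (k k' : nat) u u' :
  has_rank P k%:Z u -> has_rank P k'%:Z u' -> dim_class k u = dim_class k' u'.
Proof.
move=> /(has_rank_iter_nat k') h /(has_rank_iter_nat k) h'.
rewrite addnC in h'; have [m e] := has_rank_unique no_sink h h'.
rewrite -(dim_class_iter k') -(dim_class_iter k k') addnC.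
by rewrite -(dim_class_iter m) -[RHS](dim_class_iter m) (funext e).
Qed.

Definition dim_of (P : grProj L) : dim_group At :=
  let: exist k h := cid (has_rank_ex no_sink P) in dim_class k (projT1 (cid h)).

Lemma dim_ofE (P : grProj L) (k : nat) u : has_rank P k%:Z u -> dim_of P = dim_class k u.
Proof.
move=> h; rewrite /dim_of; case: cid => k' h'; case: cid => u' hu' /=.
exact: has_rank_class hu' h.
Qed.

Lemma dim_of_iso (P Q : grProj L) : gr_iso P Q <-> dim_of P = dim_of Q.
Proof.
have [k [u hP]] := has_rank_ex no_sink P; have [k' [u' hQ]] := has_rank_ex no_sink Q.
split=> [PQ|]; first by rewrite (dim_ofE hP) (dim_ofE (has_rank_transport PQ hP)).
rewrite (dim_ofE hP) (dim_ofE hQ) => /dim_class_eq[m [m' [e1 e2]]].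
have := has_rank_iter_nat m' hQ; rewrite -e1 -e2; apply: has_rank_iso.
exact: has_rank_iter_nat.
Qed.

Lemma dim_of_sum P Q : dim_of (gp_sum P Q) = dim_of P + dim_of Q.
Proof.
have [k [u hP]] := has_rank_ex no_sink P; have [k' [u' hQ]] := has_rank_ex no_sink Q.
have {}hP := has_rank_iter_nat k' hP; have {}hQ := has_rank_iter_nat k hQ.
rewrite addnC in hQ; rewrite (dim_ofE hP) (dim_ofE hQ).
by rewrite (dim_ofE (P := gp_sum P Q) (has_rank_sum hP hQ)) /dim_class rank_vecD dim_clsD.
Qed.

Lemma dim_of_zero : dim_of (gp_zero L) = 0.
Proof.
rewrite (dim_ofE (P := gp_zero L) (k := 0%N) (has_rank_zero K E 0)) /dim_class.
by congr dim_cls; apply/matrixP => i j; rewrite !mxE.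
Qed.

Lemma dim_of_shift P : dim_of (gp_shift 1 P) = dim_delta (dim_of P).
Proof.
have [k [u hP]] := has_rank_ex no_sink P; rewrite (dim_ofE hP) dim_deltaE rank_vec_step.
apply: dim_ofE; apply: has_rank_shift; rewrite addrC.
exact: has_rank_step.
Qed.

Lemma dim_of_surj k (u : 'cV[nat]_n) : exists P, dim_of P = dim_cls At k (map_mx Posz u).
Proof.
have [o' oK _] := o_bij.
have [P hP] := has_rank_realize K k%:Z (fun v => u (o' v) 0).
exists P; rewrite (dim_ofE hP); congr dim_cls.
by apply/matrixP => i j; rewrite !mxE oK (ord1 j).
Qed.

(** The map is written on representatives of the classes involved; K0_dimE shows
    that the choice does not matter. *)
Definition K0_dim (x : K0gr L) : dim_group At :=
  dim_of (quo_repr (quo_repr x).1) - dim_of (quo_repr (quo_repr x).2).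

Lemma K0_dimE P Q : K0_dim (K0gr_diff (grV_cls P) (grV_cls Q)) = dim_of P - dim_of Q.
Proof.
rewrite /K0_dim; have := K0gr_reprP (grV_cls P) (grV_cls Q).
case: (quo_repr _) => a b [s /=]; elim/grV_ind: a => P'; elim/grV_ind: b => Q'.
elim/grV_ind: s => S; rewrite !grV_addE => /grV_eqP/dim_of_iso.
rewrite !dim_of_sum => /addIr e.
rewrite (proj1 (dim_of_iso _ _) (grV_reprP P')) (proj1 (dim_of_iso _ _) (grV_reprP Q')).
by apply/eqP; rewrite subr_eq addrAC eq_sym subr_eq e.
Qed.

Lemma K0_ind (p : K0gr L -> Prop) :
  (forall P Q, p (K0gr_diff (grV_cls P) (grV_cls Q))) -> forall x, p x.
Proof.
move=> h; elim/K0gr_ind=> a b; elim/grV_ind: a => P; elim/grV_ind: b => Q.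
exact: h.
Qed.

(** Additivity turns equal differences into an equality of the invariants of two
    direct sums, which are then isomorphic. *)
Lemma K0_dim_inj : injective K0_dim.
Proof.
elim/K0_ind=> P Q; elim/K0_ind=> P' Q'; rewrite !K0_dimE => e.
apply/K0gr_diffP; exists (grV_cls (gp_zero L)) => /=; congr grV_add.
rewrite !grV_addE; apply/grV_eqP/dim_of_iso; rewrite !dim_of_sum.
by apply/eqP; rewrite -subr_eq addrAC e subrK.
Qed.

Lemma K0_dim_surj d : exists x, K0_dim x = d.
Proof.
elim/dim_ind: d => k u.
have [P hP] := dim_of_surj k (\col_i (if (0 <= u i 0) then `|u i ord0|%N else 0%N)).
have [Q hQ] := dim_of_surj k (\col_i (if (0 <= u i 0) then 0%N else `|u i ord0|%N)).
exists (K0gr_diff (grV_cls P) (grV_cls Q)); rewrite K0_dimE hP hQ.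
apply/eqP; rewrite subr_eq -dim_clsD; apply/eqP; congr dim_cls.
apply/matrixP => i j; rewrite !mxE (ord1 j) -[u i ord0]/(u i 0); case: ifP; lia.
Qed.
End DimensionClass.

Theorem theorem3p11p7 (K : fieldType) (E : finDigraph) (n : nat)
    (o : 'I_n -> vertex E) (o_bij : bijective o)
    (no_sink : forall v : vertex E, exists a : edge E, src a = v) :
  let At : 'M[nat]_n := (adjacency o)^T in
  exists phi : K0gr (leavitt_path_algebra K E) -> dim_group At,
    [/\ bijective phi,
        forall u v, phi (K0gr_add u v) = phi u + phi v,
        forall u, phi (K0gr_x u) = dim_delta (phi u)
      & forall d : dim_group At,
          dim_pos d <-> exists u, K0gr_pos u /\ phi u = d].
Proof.
move=> At; exists (K0_dim o no_sink); split.
- have /choice[g gK] := K0_dim_surj K o_bij no_sink.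
  exists g => // x; apply: (K0_dim_inj o_bij (no_sink := no_sink)); exact: gK.
- elim/K0_ind=> P Q; elim/K0_ind=> P' Q'; rewrite K0gr_addE !grV_addE !K0_dimE //.
  by rewrite !dim_of_sum // opprD addrACA.
- elim/K0_ind=> P Q; rewrite /K0gr_x K0gr_shiftE !grV_shiftE !K0_dimE // !dim_of_shift //.
  by apply/eqP; rewrite subr_eq -dim_delta_additive subrK.
move=> d; split=> [[k [u ->]]|[x [[P ->]] <-]].
  have [P <-] := dim_of_surj K o_bij no_sink k u.
  exists (K0gr_cls P); split; first by exists P.
  by rewrite K0_dimE // dim_of_zero // subr0.
rewrite K0_dimE // dim_of_zero // subr0.
have [k [u hP]] := has_rank_ex no_sink P; exists k, (\col_i u (o i)).
by rewrite (dim_ofE o_bij no_sink hP); congr dim_cls; apply/matrixP => i j; rewrite !mxE.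
Qed.
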